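(* Let $0<p<1/2$. Given $0<q<\frac{p}{1-p}$, there exist a $(1-q)$-Beurling-Carleson set $E$ and a nonzero finite positive measure $\mu$ supported on $E$ such that $S_\nu'\notin H^p$ for any measure $\nu$ with $0<\nu\le\mu$ (i.e. any nonzero positive measure $\nu\le\mu$).
   Context: $\mathbb{D}$ is the open unit disk, $\partial\mathbb{D}$ the unit circle, $|J|$ is the length of an arc $J$, and $H^p$ is the Hardy space on $\mathbb{D}$. For a finite positive singular measure $\nu$ on $\partial\mathbb{D}$, the singular inner function is $$S_\nu(z)=\exp\Bigl(-\int_{\partial\mathbb{D}}\frac{\zeta+z}{\zeta-z}\,d\nu(\zeta)\Bigr),\qquad |z|<1.$$ For $0<\alpha<1$, an $\alpha$-Beurling-Carleson set is a closed subset $E\subset\partial\mathbb{D}$ of zero length whose complementary arcs $\{J\}$ (the connected components of $\partial\mathbb{D}\setminus E$) satisfy $\sum_J|J|^\alpha<\infty$. *)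

(* Defs.v *)
From HB Require Import structures.
From mathcomp Require Import all_boot all_order all_algebra complex.
From mathcomp Require Import all_classical all_reals all_analysis.

Set Implicit Arguments.
Unset Strict Implicit.
Unset Printing Implicit Defensive.

Import Order.TTheory GRing.Theory Num.Theory.
Import numFieldNormedType.Exports.

Local Open Scope classical_set_scope.
Local Open Scope ring_scope.
Local Open Scope complex_scope.

(* [R[i]] does not inherit the norm topology of a [numFieldType]
   automatically; it is copied here, so that [R[i]] is a normed module over
   itself and [derive1 f] is the complex derivative of [f : R[i] -> R[i]]. *)
HB.instance Definition _ (R : rcfType) := PseudoPointedMetric.copy R[i] R[i]^o.
HB.instance Definition _ (R : rcfType) := GRing.ComAlgebra.copy R[i] R[i]^o.
HB.instance Definition _ (R : rcfType) := Vector.copy R[i] R[i]^o.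
HB.instance Definition _ (R : rcfType) := NormedModule.copy R[i] R[i]^o.

Section defs.
Variable R : realType.

(* Borel sigma-algebra of the plane; a measure on the circle is a measure on
   [borelC] vanishing off [circle]. *)
Definition borelC := g_sigma_algebraType (@open R[i]).

Definition disk : set R[i] := [set z | `|z| < 1].

Definition circle : set R[i] := [set z | `|z| = 1].

Definition expi (t : R) : R[i] := cos t +i* sin t.

Definition cexp (z : R[i]) : R[i] := (expR (complex.Re z))%:C * expi (complex.Im z).

Definition arclength (A : set R[i]) : \bar R :=
  lebesgue_measure (`[0, 2 * pi[ `&` expi @^-1` A).

Definition complementary_arcs (E : set R[i]) : set (set R[i]) :=
  [set connected_component (circle `\` E) z | z in circle `\` E].

Definition beurling_carleson (alpha : R) (E : set R[i]) : Prop :=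
  [/\ closed E, E `<=` circle, arclength E = 0%E &
      (\esum_(J in complementary_arcs E) (arclength J `^ alpha) < +oo)%E].

Definition cintegral (nu : {measure set borelC -> \bar R}) (D : set borelC)
    (f : R[i] -> R[i]) : R[i] :=
  (\int[nu]_(w in D) complex.Re (f w)) +i* (\int[nu]_(w in D) complex.Im (f w)).

Definition singular_inner (nu : {measure set borelC -> \bar R}) (z : R[i]) :
    R[i] :=
  cexp (- cintegral nu circle (fun w => (w + z) / (w - z))).

Definition holomorphic (D : set R[i]) (f : R[i] -> R[i]) : Prop :=
  forall z, D z -> derivable f z 1.

Definition hardy_mean (p : R) (f : R[i] -> R[i]) (r : R) : \bar R :=
  (\int[lebesgue_measure]_(t in `[0%R, (2 * pi)%R])
     ((complex.Re `|f (r%:C * expi t)|) `^ p)%:E)%E.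

(* The supremum of the integral means is finite; the usual factor 1/(2 pi) and
   power 1/p are omitted, as they do not change membership. *)
Definition hardy (p : R) : set (R[i] -> R[i]) :=
  [set f | holomorphic disk f /\
           (ereal_sup [set hardy_mean p f r | r in `[0%R, 1%R[] < +oo)%E].

End defs.

(* Main.v *)
Require Import Defs.
From mathcomp Require Import all_boot all_order all_algebra complex.
From mathcomp Require Import all_classical all_reals all_analysis.
From mathcomp Require Import measurable_realfun ring lra zify.

Import Order.TTheory GRing.Theory Num.Theory.
Import numFieldNormedType.Exports.

Local Open Scope classical_set_scope.
Local Open Scope ring_scope.
Local Open Scope complex_scope.
Import ComplexField.Normc.

(** The set E is the image under t |-> exp(i t) of a self-similar Cantor set
    in [0, 1]: every interval is replaced by its two end pieces, of relative
    length lam < 1/2.  Generation n has 2^n cells of length lam^n, and as many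
    gaps of length (1 - 2 lam) lam^n.  Hence E is (1 - q)-Beurling-Carleson as
    soon as 2 lam^(1-q) < 1.  The measure mu gives mass at most 2^-n to every
    cell of generation n.

    Let nu <= mu be nonzero and let t be an angle in the middle third of the
    gap of a cell I of generation n.  All points of I are at distance at most
    lam^n from exp(i t), so that

      | S_nu'(exp(i t)) | = int 2 / |w - exp(i t)|^2 dnu(w)
                         >= 2 lam^(-2n) nu(I).

    Since 0 <= nu(I) <= 2^-n and p < 1, one has nu(I)^p >= 2^(n(1-p)) nu(I).
    Integrating over the 2^n disjoint middle thirds and summing, the p-th
    integral mean of S_nu' is at least a constant times

      lam^n lam^(-2np) 2^(n(1-p)) sum_I nu(I) = (lam^(1-2p) 2^(1-p))^n nu(E),

    which is unbounded in n when lam^(1-2p) 2^(1-p) > 1.  For lam = 2^-s the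
    two conditions on lam read 1/(1-q) < s < (1-p)/(1-2p), and such an s exists
    precisely because q < p/(1-p) (cantor_ratio_exists).

    Membership in H^p is tested inside the disk, so the boundary estimate is
    carried out on a circle of radius r_n < 1 with 1 - r_n an eighth of the
    squared distance from the middle thirds to E: there |S_nu| stays
    bounded below and the kernel of the derivative keeps, after
    multiplication by exp(i t), a real part of constant sign
    (poisson_kernel_le, dherglotz_kernel_ge, derivative_lower).  The means over
    these circles are bounded below in hardy_mean_lower. *)

(** * The complex plane and the unit circle *)

Section complex_plane.
Set Implicit Arguments.
Unset Strict Implicit.
Context {R : realType}.
Implicit Types (z w h : R[i]).

Lemma normc_normr z : `|z| = (normc z)%:C.
Proof. by []. Qed.

Lemma normc_sqr z : normc z ^+ 2 = complex.Re z ^+ 2 + complex.Im z ^+ 2.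
Proof. by case: z => a b /=; rewrite sqr_sqrtr// addr_ge0// sqr_ge0. Qed.

Lemma normc_ge0 z : 0 <= normc z.
Proof. by case: z => a b /=; rewrite sqrtr_ge0. Qed.

Lemma normc_Re z : `|complex.Re z| <= normc z.
Proof.
case: z => a b /=; rewrite -sqrtr_sqr ler_sqrt ?lerDl ?sqr_ge0//.
by rewrite addr_ge0// sqr_ge0.
Qed.

Lemma normc_Im z : `|complex.Im z| <= normc z.
Proof.
case: z => a b /=; rewrite -sqrtr_sqr ler_sqrt ?lerDr ?sqr_ge0//.
by rewrite addr_ge0// sqr_ge0.
Qed.

Lemma normc_leD (a b : R) : normc (a +i* b) <= `|a| + `|b|.
Proof.
rewrite -(@ler_pXn2r _ 2)// ?nnegrE ?normc_ge0 ?addr_ge0//.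
rewrite normc_sqr /= sqrrD !real_normK ?num_real// addrAC lerDl mulrn_wge0//.
Qed.

Lemma normc_gt0 z : (0 < normc z) = (z != 0).
Proof.
rewrite lt_neqAle normc_ge0 andbT eq_sym; congr (~~ _).
apply/eqP/eqP => [/eq0_normc//|->]; exact: normc0.
Qed.

(** Neighbourhoods in R[i] are defined by radii in R[i]; real radii are enough
    and are what the estimates below provide. *)
Lemma nbhs_normcP z (A : set R[i]) :
  nbhs z A <-> exists2 e : R, 0 < e & forall w, normc (w - z) < e -> A w.
Proof.
split.
- move=> /nbhs_ballP[e /= e0 Ae]; have := e0; rewrite ltcE /= => /andP[/eqP ie re].
  exists (complex.Re e) => // w wz; apply: Ae; rewrite -ball_normE /=.
  by rewrite distrC normc_normr ltcE /= ie eqxx.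
- move=> [e e0 Ae]; apply/nbhs_ballP; exists e%:C => /=; first by rewrite ltcR.
  move=> w; rewrite -ball_normE /= distrC normc_normr ltcR; exact: Ae.
Qed.

Lemma continuous_Re : continuous (@complex.Re R : R[i] -> R).
Proof.
move=> z A /nbhs_ballP[e /= e0 eA]; apply/nbhs_normcP; exists e => // w wz.
apply: eA; rewrite -ball_normE /= distrC; apply: le_lt_trans wz.
by rewrite (_ : _ - _ = complex.Re (w - z)) ?normc_Re//; case: (w) (z) => [? ?] [].
Qed.

Lemma continuous_Im : continuous (@complex.Im R : R[i] -> R).
Proof.
move=> z A /nbhs_ballP[e /= e0 eA]; apply/nbhs_normcP; exists e => // w wz.
apply: eA; rewrite -ball_normE /= distrC; apply: le_lt_trans wz.
by rewrite (_ : _ - _ = complex.Im (w - z)) ?normc_Im//; case: (w) (z) => [? ?] [].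
Qed.

Lemma continuous_complex (T : topologicalType) (f g : T -> R) :
  continuous f -> continuous g -> continuous (fun t => (f t +i* g t) : R[i]).
Proof.
move=> cf cg t A /nbhs_normcP[e e0 eA].
have e20 : 0 < e / 2 by rewrite divr_gt0.
have /cvgr_dist_lt/(_ _ e20) Hf := cf t.
have /cvgr_dist_lt/(_ _ e20) Hg := cg t.
change (\forall s \near t, A (f s +i* g s)).
apply: filterS2 Hf Hg => s fs gs; apply: eA.
rewrite (_ : _ - _ = (f s - f t) +i* (g s - g t))//.
apply: (le_lt_trans (normc_leD _ _)).
by rewrite [ltRHS]splitr ltrD// distrC.
Qed.

Lemma continuous_expi : continuous (@expi R).
Proof. by apply: continuous_complex; [exact: continuous_cos|exact: continuous_sin]. Qed.

Lemma expiD (s t : R) : expi (s + t) = expi s * expi t.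
Proof.
rewrite /expi cosD sinD; apply/eqP; rewrite eq_complex /=.
by rewrite eqxx addrC eqxx.
Qed.

Lemma normc_expi (t : R) : normc (expi t) = 1.
Proof. by rewrite /= cos2Dsin2 sqrtr1. Qed.

Lemma circleP z : circle z <-> normc z = 1.
Proof.
rewrite /circle /= normc_normr; split => [|->//].
by move=> /complexI.
Qed.

Lemma circle_expi (t : R) : circle (expi t).
Proof. by apply/circleP; exact: normc_expi. Qed.

(** The arc cosine of the real part serves the closed upper half circle, and
    reflection the lower one. *)
Lemma circle_arg z : circle z -> exists2 t : R, 0 <= t < 2 * pi & z = expi t.
Proof.
move=> /circleP nz.
have := normc_sqr z; rewrite nz expr1n; case: z nz => a b /= nz ab.
have a1 : -1 <= a <= 1.
  by rewrite -ler_norml -[leRHS]nz; exact: (normc_Re (a +i* b)).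
have sb : sin (acos a) = `|b|.
  by rewrite sin_acos// ab addrC addKr sqrtr_sqr.
have pi0 := pi_gt0 R.
have [b0|b0] := leP 0 b.
- exists (acos a).
    rewrite acos_ge0//=; apply: (le_lt_trans (acos_lepi a1)); lra.
  by rewrite /expi acosK ?itv_boundlr// sb ger0_norm.
- exists (2 * pi - acos a).
    apply/andP; split; first by have := acos_lepi a1; lra.
    rewrite ltrBlDr ltrDl acos_gt0//; case/andP: a1 => -> /=.
    rewrite le_eqVlt => /predU1P[a1|//]; move: ab b0.
    by rewrite a1 expr1n => h b0; nra.
  rewrite /expi.
  have -> : 2 * pi - acos a = - acos a + pi *+ 2 :> R by ring.
  by rewrite cosD2pi sinD2pi cosN sinN acosK ?itv_boundlr// sb ltr0_norm// opprK.
Qed.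

End complex_plane.

(** * Arcs of the circle and connected components *)

Section arcs.
Set Implicit Arguments.
Unset Strict Implicit.
Context {R : realType}.
Implicit Types (z w : R[i]) (E : set R[i]) (a b s t : R).

Lemma cos_eq1 t : 0 <= t < 2 * pi -> cos t = 1 -> t = 0.
Proof.
move=> /andP[t0 t2] ct; have pi0 := pi_gt0 R.
have [tp|tp] := leP t pi.
  by apply: cos_inj; rewrite ?in_itv/= ?lexx ?t0 ?tp ?ltW// cos0.
have : 2 * pi - t = 0 :> R.
  apply: cos_inj; rewrite ?in_itv/= ?lexx//; [lra|lra|].
  have -> : 2 * pi - t = - t + pi *+ 2 :> R by ring.
  by rewrite cosD2pi cosN ct cos0.
by lra.
Qed.

Lemma expi_inj s t : `|s - t| < 2 * pi -> expi s = expi t -> s = t.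
Proof.
move=> st [cst sst]; apply/eqP; rewrite -subr_eq0 -normr_eq0; apply/eqP.
apply: cos_eq1; first by rewrite normr_ge0.
by rewrite cos_norm cosB cst sst -!expr2 cos2Dsin2.
Qed.

Lemma expiD2pi t : expi (t + 2 * pi) = expi t.
Proof.
have -> : t + 2 * pi = t + pi *+ 2 by ring.
by rewrite /expi cosD2pi sinD2pi.
Qed.

Lemma circle_arg_from a z : 0 <= a <= 2 * pi -> circle z ->
  exists2 t, a <= t < a + 2 * pi & z = expi t.
Proof.
move=> ha /circle_arg[t ht ->]; have [at_|ta] := leP a t.
  by exists t => //; lra.
by exists (t + 2 * pi); rewrite ?expiD2pi//; lra.
Qed.

Lemma expi_closed (K : set R) : compact K -> closed (@expi R @` K).
Proof.
move=> cK; apply: compact_closed; first exact: norm_hausdorff.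
by apply: continuous_compact => //; apply: continuous_subspaceT; exact: continuous_expi.
Qed.

(** An open arc is clopen in the circle deprived of its endpoints: its closure
    and its complement are both images of compact intervals. *)
Lemma component_arc E a b z : 0 <= a -> a < b -> b <= 2 * pi ->
  E `<=` @circle R -> E (expi a) -> E (expi b) ->
  @expi R @` `]a, b[ `<=` ~` E -> (@expi R @` `]a, b[) z ->
  connected_component (@circle R `\` E) z = @expi R @` `]a, b[.
Proof.
move=> a0 ab b2 Ec Ea Eb abE abz; apply/seteqP; split; last first.
  apply: connected_component_max => //.
  - by move=> w abw; split; [case: abw => t _ <-; exact: circle_expi|exact: abE].
  - apply: connected_continuous_connected.
      by apply/connected_intervalP; exact: interval_is_interval.
    by apply: continuous_subspaceT; exact: continuous_expi.
set C := connected_component _ _.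
have CE : C `<=` @circle R `\` E by exact: connected_component_sub.
have Cz : C z.
  apply: connected_component_refl; split; last exact: abE.
  by case: abz => t _ <-; exact: circle_expi.
(* The trace of the arc on the component is relatively open and closed. *)
suff -> : C = C `&` @expi R @` `]a, b[ by apply: subIsetr.
apply/esym; apply: component_connected.
- by exists z.
- exists (~` (@expi R @` `[b, a + 2 * pi])).
    by apply: closed_openC; apply: expi_closed; exact: segment_compact.
  apply/seteqP; split => [w [Cw [t]]|w [Cw nw]].
    rewrite /= in_itv/= => /andP[at_ tb] wt; split => // -[s] /=.
    rewrite in_itv/= -wt => /andP[bs sa].
    move/expi_inj => st; have : s = t by apply: st; rewrite gtr0_norm; lra.
    lra.
  split => //; have [wc wE] := CE _ Cw.
  have [|t /andP[at_ ta] wt] := @circle_arg_from a w _ wc; first by lra.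
  exists t => //=; rewrite in_itv/=; apply/andP; split.
    rewrite lt_neqAle at_ andbT; apply/eqP => ate; apply: wE.
    by rewrite wt -ate.
  rewrite ltNge; apply/negP => bt; apply: nw; exists t => //=.
  by rewrite in_itv/= bt ltW.
- exists (@expi R @` `[a, b]); first by apply: expi_closed; exact: segment_compact.
  apply/seteqP; split => w [Cw [t /=]]; rewrite in_itv/= => tab wt.
    by split => //; exists t => //=; rewrite in_itv/=; lra.
  split => //; exists t => //=; rewrite in_itv/= !lt_neqAle.
  have [_ nE] := CE _ Cw; case/andP: tab => -> ->; rewrite !andbT.
  by apply/andP; split; apply/eqP => ate; apply: nE; rewrite -wt -?ate// ate.
Qed.

Lemma arclength_expi (K : set R) : K `<=` `[0, 2 * pi[ ->
  arclength (@expi R @` K) = lebesgue_measure K.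
Proof.
move=> K2; congr lebesgue_measure; apply/seteqP; split.
- move=> t [/=]; rewrite in_itv/= => t2 [s Ks] /expi_inj <-//.
  by have := K2 _ Ks; rewrite /= in_itv/= => s2; rewrite ltr_norml; lra.
- by move=> t Kt; split; [exact: K2|exists t].
Qed.

End arcs.

(** * A self-similar Cantor set in the unit interval *)

Section cantor_set.
Set Implicit Arguments.
Unset Strict Implicit.
Context {R : realType}.
Variable lam : R.
Hypotheses (lam0 : 0 < lam) (lam12 : lam < 1 / 2).
Implicit Types (n k j : nat) (x t : R).

(** The lowest binary digit of k is the latest choice between the left and
    the right piece, so that the cell of index k lies in that of index k./2. *)
Fixpoint cell_start n k : R :=
  if n is m.+1 then
    cell_start m k./2 + (odd k)%:R * ((1 - lam) * lam ^+ m)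
  else 0.

Definition cell n k : set R := `[cell_start n k, cell_start n k + lam ^+ n]%classic.

Definition gap_lo n k := cell_start n k + lam ^+ n.+1.
Definition gap_hi n k := cell_start n k + lam ^+ n - lam ^+ n.+1.

Definition cantor_step n : set R := \bigcup_(k in `I_(2 ^ n)) cell n k.

Definition cantor_set : set R := \bigcap_n cantor_step n.

Lemma lamX_gt0 n : 0 < lam ^+ n. Proof. exact: exprn_gt0. Qed.

Lemma lamXS_lt n : 2 * lam ^+ n.+1 < lam ^+ n.
Proof. by rewrite exprS mulrA gtr_pMl ?lamX_gt0//; have := lam12; lra. Qed.

Lemma cellP n k x :
  cell n k x <-> cell_start n k <= x <= cell_start n k + lam ^+ n.
Proof. by rewrite /cell /= in_itv. Qed.

Lemma cell_startS n k b : (b < 2)%N ->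
  cell_start n.+1 (k.*2 + b) = cell_start n k + b%:R * ((1 - lam) * lam ^+ n).
Proof.
case: b => [|[|]]// _; first by rewrite addn0 /= odd_double doubleK.
by rewrite addn1 /= odd_double uphalf_double.
Qed.

Lemma cell_half n k : cell n.+1 k `<=` cell n k./2.
Proof.
move=> x /cellP /= /andP[h1 h2]; apply/cellP; move: h1 h2.
have := lamX_gt0 n; rewrite exprS; move: (lam ^+ n) => y y0.
have := lam12; have := lam0; case: (odd k); rewrite ?mul1r ?mul0r => l0 l1 h1 h2;
  by apply/andP; split; nra.
Qed.

Lemma cell_ancestor j n k : cell (n + j) k `<=` cell n (k %/ 2 ^ j).
Proof.
elim: j k => [|j IH] k; first by rewrite addn0 divn1.
rewrite addnS => x /cell_half/IH; congr (cell n _ x).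
by rewrite expnS divnMA divn2.
Qed.

Lemma cell_unit n k : cell n k `<=` `[0, 1].
Proof.
rewrite -[n]add0n => x /cell_ancestor /cellP /=.
by rewrite expr0 add0r in_itv.
Qed.

(** The pieces of one cell are disjoint because 2 * lam < 1, and pieces of
    different cells inherit the separation of their parents. *)
Lemma cell_sep n k j : (k < j)%N -> (j < 2 ^ n)%N ->
  cell_start n k + lam ^+ n < cell_start n j.
Proof.
elim: n k j => [|n IH] k j kj jn; first by rewrite expn0 in jn; lia.
have hS := lamXS_lt n; have h0 := lamX_gt0 n; have h1 := lamX_gt0 n.+1.
have hd (i : nat) : i = (odd i + i./2.*2)%N by rewrite odd_double_half.
have [e|ne] := eqVneq k./2 j./2.
  have [ok oj] : odd k = false /\ odd j = true.
    by have := hd k; have := hd j; rewrite e; case: (odd k); case: (odd j) => /=; lia.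
  by rewrite /= e ok oj mul1r mul0r addr0 ltrD2l mulrBl mul1r -exprS; lra.
have kj2 : (k./2 < j./2)%N by have := half_leq (ltnW kj); rewrite leq_eqVlt (negbTE ne).
have jn2 : (j./2 < 2 ^ n)%N by rewrite ltn_half_double -mul2n -expnS.
have := IH _ _ kj2 jn2; rewrite /= mulrBl mul1r -exprS.
by case: (odd k); case: (odd j); rewrite ?mul1r ?mul0r; lra.
Qed.

Lemma cell_inj n k j x : (k < 2 ^ n)%N -> (j < 2 ^ n)%N ->
  cell n k x -> cell n j x -> k = j.
Proof.
move=> kn jn /cellP hk /cellP hj; case: (ltngtP k j) => // h.
- by exfalso; have := cell_sep h jn; lra.
- by exfalso; have := cell_sep h kn; lra.
Qed.

Lemma cell_start_le n k j : (k <= j)%N -> (j < 2 ^ n)%N ->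
  cell_start n k <= cell_start n j.
Proof.
rewrite leq_eqVlt => /predU1P[->//|kj jn].
by have := cell_sep kj jn; have := lamX_gt0 n; lra.
Qed.

(** Cells are contained in their ancestors, so that the early generations come
    for free; this is how endpoints are shown to belong to the Cantor set. *)
Lemma cantor_setP n x :
  (forall j, exists2 k, (k < 2 ^ (n + j))%N & cell (n + j) k x) -> cantor_set x.
Proof.
move=> h m _; have [k kn kx] := h m; exists (k %/ 2 ^ n)%N.
  by rewrite /= ltn_divLR ?expn_gt0// -expnD addnC.
by apply: cell_ancestor; rewrite addnC.
Qed.

Lemma cell_start_iter n k j : cell_start (n + j) (k * 2 ^ j) = cell_start n k.
Proof.
elim: j => [|j IH]; first by rewrite addn0 muln1.
rewrite addnS expnS mulnCA mul2n -[X in cell_start _ X]addn0 cell_startS//.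
by rewrite mul0r addr0.
Qed.

Lemma cell_end_iter n k j :
  cell_start (n + j) (k * 2 ^ j + (2 ^ j).-1) + lam ^+ (n + j) =
  cell_start n k + lam ^+ n.
Proof.
elim: j => [|j IH]; first by rewrite addn0 expn0 muln1 addn0.
rewrite addnS expnS mulnCA mul2n.
have -> : ((k * 2 ^ j).*2 + (2 * 2 ^ j).-1 = (k * 2 ^ j + (2 ^ j).-1).*2 + 1)%N.
  by have := expn_gt0 2 j; lia.
rewrite cell_startS// mul1r -IH exprS; ring.
Qed.

Lemma cantor_cell_start n k : (k < 2 ^ n)%N -> cantor_set (cell_start n k).
Proof.
move=> kn; apply: (@cantor_setP n) => j; exists (k * 2 ^ j)%N.
  by rewrite expnD ltn_pmul2r ?expn_gt0.
by apply/cellP; rewrite cell_start_iter lexx lerDl ltW ?lamX_gt0.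
Qed.

Lemma cantor_cell_end n k : (k < 2 ^ n)%N ->
  cantor_set (cell_start n k + lam ^+ n).
Proof.
move=> kn; apply: (@cantor_setP n) => j; exists (k * 2 ^ j + (2 ^ j).-1)%N.
  by rewrite expnD; have := expn_gt0 2 j; nia.
apply/cellP; rewrite cell_end_iter lexx andbT -(cell_end_iter n k j).
by rewrite lerDl ltW ?lamX_gt0.
Qed.

Lemma cantor_gap_lo n k : (k < 2 ^ n)%N -> cantor_set (gap_lo n k).
Proof.
move=> kn; have /cantor_cell_end : (k.*2 + 0 < 2 ^ n.+1)%N by rewrite expnS; lia.
by rewrite cell_startS// mul0r addr0.
Qed.

Lemma cantor_gap_hi n k : (k < 2 ^ n)%N -> cantor_set (gap_hi n k).
Proof.
move=> kn; have /cantor_cell_start : (k.*2 + 1 < 2 ^ n.+1)%N by rewrite expnS; lia.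
rewrite cell_startS//; congr cantor_set; rewrite /gap_hi exprS; ring.
Qed.

Lemma gap_size n k : gap_hi n k - gap_lo n k = (1 - 2 * lam) * lam ^+ n.
Proof. by rewrite /gap_hi /gap_lo exprS; ring. Qed.

Lemma gap_lt n k : gap_lo n k < gap_hi n k.
Proof. by rewrite -subr_gt0 gap_size mulr_gt0 ?lamX_gt0//; have := lam12; lra. Qed.

Lemma gap_cell n k : `]gap_lo n k, gap_hi n k[ `<=` cell n k.
Proof.
move=> x /=; rewrite in_itv/= /gap_lo /gap_hi => h; apply/cellP.
by have := lamX_gt0 n.+1; lra.
Qed.

Lemma gap_cantor n k x : (k < 2 ^ n)%N -> gap_lo n k < x < gap_hi n k ->
  ~ cantor_set x.
Proof.
move=> kn kx /(_ n.+1 Logic.I)[j /= jn jx].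
have jk : j./2 = k.
  apply: (@cell_inj n _ _ x) => //; last by apply: gap_cell; rewrite /= in_itv.
    by rewrite ltn_half_double -mul2n -expnS.
  exact: cell_half.
move: jx kx => /cellP /=; rewrite jk /gap_lo /gap_hi mulrBl mul1r -exprS.
by case: (odd j); rewrite ?mul1r ?mul0r; lra.
Qed.

(** A point of [0, 1] in no gap descends for ever through the cells that
    contain it. *)
Lemma cantor_compl x : 0 <= x <= 1 -> ~ cantor_set x ->
  exists n k, (k < 2 ^ n)%N /\ gap_lo n k < x < gap_hi n k.
Proof.
move=> x01 nx; apply: contrapT => nG; apply: nx => n _.
elim: n => [|n [k /= kn kx]].
  by exists 0%N => //; apply/cellP; rewrite expr0 add0r.
have [h1|h1] := leP x (gap_lo n k).
  exists (k.*2 + 0)%N => /=; first by rewrite expnS; lia.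
  apply/cellP; rewrite cell_startS// mul0r addr0.
  by move/cellP: kx => /andP[-> _].
have [h2|h2] := leP (gap_hi n k) x.
  exists (k.*2 + 1)%N => /=; first by rewrite expnS; lia.
  apply/cellP; rewrite cell_startS// mul1r exprS.
  move/cellP: kx => /andP[_]; move: h2; rewrite /gap_hi exprS => h2 h3.
  by apply/andP; split; lra.
by case: nG; exists n, k; rewrite h1 h2.
Qed.

Lemma cantor_closed : closed cantor_set.
Proof.
apply: closed_bigI => n _; apply: closed_bigcup; first exact: finite_II.
by move=> k _; exact: itv_closed.
Qed.

Lemma cantor_unit : cantor_set `<=` `[0, 1].
Proof. by move=> x /(_ 0%N Logic.I)[k _ /cell_unit]. Qed.

Lemma cantor_compact : compact cantor_set.
Proof.
by apply: subclosed_compact cantor_closed (@segment_compact _ 0 1) cantor_unit.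
Qed.

Lemma measurable_cell n k : measurable (cell n k).
Proof. exact: measurable_itv. Qed.

Lemma measurable_cantor_step n : measurable (cantor_step n).
Proof. by apply: bigcup_measurable => k _; exact: measurable_cell. Qed.

(** The cells of generation n cover, and their total length is (2 * lam) ^ n. *)
Lemma cantor_null : lebesgue_measure cantor_set = 0%E.
Proof.
have mC : measurable cantor_set.
  by apply: bigcap_measurable => // n _; exact: measurable_cantor_step.
have step n : (lebesgue_measure cantor_set <= ((2 * lam) ^+ n)%:E)%E.
  have cover : cantor_set `<=` \big[setU/set0]_(k < 2 ^ n) cell n k.
    by rewrite -bigcup_mkord => x; apply.
  have mcell k : `I_(2 ^ n) k -> measurable (cell n k).
    by move=> _; exact: measurable_cell.
  apply: (le_trans (content_subadditive lebesgue_measure mcell mC cover)).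
  rewrite (eq_bigr (fun=> (lam ^+ n)%:E)) => [|k _].
    by rewrite sumEFin sumr_const card_ord exprMn -natrX mulr_natl.
  transitivity (lebesgue_measure (cell n k : set R)) => //.
  rewrite /cell lebesgue_measure_itv /= lte_fin ltrDl lamX_gt0.
  by rewrite -EFinB addrAC subrr add0r.
apply/eqP; rewrite eq_le measure_ge0 andbT; apply/lee_addgt0Pr => e e0.
rewrite add0e.
have /cvgr0_norm_lt/(_ _ e0) [n _ /(_ n (leqnn _)) hn] :
    (2 * lam) ^+ n @[n --> \oo] --> 0.
  by have l1 := lam12; have l0 := lam0; apply: cvg_expr; rewrite ger0_norm; lra.
apply: (le_trans (step n)); rewrite lee_fin ltW//.
exact: le_lt_trans (ler_norm _) hn.
Qed.

(** * The parametrisation of the Cantor set by binary digits *)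

(** The cap keeps the index below 2 ^ n also for t >= 1, so that the
    parametrisation is defined and monotone on the whole line. *)
Definition binary_index n t := minn (Num.truncn (2 ^+ n * t)) (2 ^ n).-1.

Lemma binary_index_lt n t : (binary_index n t < 2 ^ n)%N.
Proof. by rewrite /binary_index; have := expn_gt0 2 n; lia. Qed.

Lemma truncn_double t : (Num.truncn (2 * t))./2 = Num.truncn t.
Proof.
have [t0|t0] := ltP t 0.
  have tr0 (y : R) : y < 0 -> Num.truncn y = 0%N.
    by move=> y0; apply/truncn0Pn; rewrite -ltNge; lra.
  by rewrite !tr0//; lra.
apply/esym/truncn_def; set N := Num.truncn _.
have /truncn_itv : 0 <= 2 * t by lra.
rewrite -/N => /andP[h1 h2].
have := odd_double_half N; set m := N./2 => Nm.
have : N%:R = (odd N)%:R + 2 * m%:R :> R by rewrite -natrM mul2n -natrD Nm.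
move: h2; rewrite -!natr1 => h2 h3.
by move: h3; case: (odd N) => /= h3; apply/andP; split; lra.
Qed.

Lemma binary_index_half n t : (binary_index n.+1 t)./2 = binary_index n t.
Proof.
rewrite /binary_index exprS -mulrA.
have := truncn_double (2 ^+ n * t); move: (Num.truncn _) (Num.truncn _) => A B.
by rewrite expnS; have := expn_gt0 2 n; lia.
Qed.

Lemma binary_index_ancestor j n t :
  (binary_index (n + j) t %/ 2 ^ j)%N = binary_index n t.
Proof.
elim: j => [|j IH]; first by rewrite addn0 divn1.
by rewrite addnS expnS divnMA divn2 binary_index_half.
Qed.

Lemma binary_index_le n t t' : t <= t' -> (binary_index n t <= binary_index n t')%N.
Proof.
move=> tt; rewrite /binary_index leq_min geq_minr andbT.
apply: leq_trans (geq_minl _ _) _; apply: le_truncn.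
by rewrite ler_wpM2l// exprn_ge0.
Qed.

(** The binary digits of t in [0, 1] are read as an address in the Cantor
    construction; on [0, 1[ this is a section of the Cantor function. *)
Definition cantor_fun t : R := sup [set cell_start n (binary_index n t) | n in setT].

Let cstart n t := cell_start n (binary_index n t).

Lemma cell_start_nested n j t : cell n (binary_index n t) (cstart (n + j) t).
Proof.
rewrite -(binary_index_ancestor j); apply: cell_ancestor; apply/cellP.
by rewrite lexx lerDl ltW ?lamX_gt0.
Qed.

Lemma cstart_le_end n m t : cstart m t <= cstart n t + lam ^+ n.
Proof.
have [nm|mn] := leqP n m.
  by have /cellP/andP[_] := cell_start_nested n (m - n) t; rewrite subnKC.
have /cellP/andP[h _] := cell_start_nested m (n - m) t.
move: h; rewrite subnKC ?(ltnW mn)// => h; apply: (le_trans h).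
by rewrite lerDl ltW ?lamX_gt0.
Qed.

Lemma cstart_bound t : has_sup [set cstart n t | n in setT].
Proof.
split; first by exists (cstart 0 t), 0%N.
by exists (cstart 0 t + lam ^+ 0) => _ [n _ <-]; exact: cstart_le_end.
Qed.

Lemma cantor_fun_cell n t : cell n (binary_index n t) (cantor_fun t).
Proof.
apply/cellP/andP; split.
  by apply: sup_upper_bound; [exact: cstart_bound|exists n].
apply: ge_sup; first by case: (cstart_bound t).
by move=> _ [m _ <-]; exact: cstart_le_end.
Qed.

Lemma cantor_funP t : cantor_set (cantor_fun t).
Proof.
by move=> n _; exists (binary_index n t); [exact: binary_index_lt|exact: cantor_fun_cell].
Qed.

(** Monotonicity is what makes the parametrisation measurable. *)
Lemma cantor_fun_le : {homo cantor_fun : t t' / t <= t'}.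
Proof.
move=> t t' tt; apply: ge_sup; first by case: (cstart_bound t).
move=> _ [n _ <-].
apply: (@le_trans _ _ (cstart n t')); last first.
  by apply: sup_upper_bound; [exact: cstart_bound|exists n].
by apply: cell_start_le; [exact: binary_index_le|exact: binary_index_lt].
Qed.

(** Cells of one generation are disjoint, so the cell containing the image of
    t determines the first n digits of t. *)
Lemma cantor_fun_preimage n k : (k < 2 ^ n)%N ->
  cantor_fun @^-1` cell n k `&` `[0, 1] `<=`
  `[k%:R / 2 ^+ n, k.+1%:R / 2 ^+ n].
Proof.
move=> kn t [/= tk]; rewrite !in_itv/= => /andP[t0 t1].
have n0 : 0 < (2 ^+ n : R) by rewrite exprn_gt0.
have <- := cell_inj (binary_index_lt n t) kn (cantor_fun_cell n t) tk.
have tn0 : 0 <= 2 ^+ n * t by rewrite mulr_ge0// ltW.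
have /andP[h1 h2] := truncn_itv tn0.
rewrite ler_pdivrMr// ler_pdivlMr// ![t * _]mulrC /binary_index.
apply/andP; split.
  by apply: le_trans h1; rewrite ler_nat geq_minl.
have [tr|tr] := leqP (Num.truncn (2 ^+ n * t)) (2 ^ n).-1; first exact: ltW.
by rewrite prednK ?expn_gt0// natrX ger_pMr.
Qed.

End cantor_set.

(** * Sums over gaps and the Beurling-Carleson condition *)

Lemma powR_exprn (R : realType) (x a : R) n : 0 <= x ->
  (x ^+ n) `^ a = (x `^ a) ^+ n.
Proof.
move=> x0; elim: n => [|n IH]; first by rewrite !expr0 powR1.
by rewrite !exprS powRM ?exprn_ge0// IH.
Qed.

Section esum_extra.
Set Implicit Arguments.
Unset Strict Implicit.
Context {R : realType}.
Local Open Scope ereal_scope.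

Lemma esum_sub (T : choiceType) (A B : set T) (a : T -> \bar R) :
  A `<=` B -> \esum_(i in A) a i <= \esum_(i in B) a i.
Proof.
move=> AB; apply: le_ereal_sup => _ [F [finF FA] <-]; exists F => //.
by split => //; exact: subset_trans FA AB.
Qed.

(** Only an inequality, as several indices may have the same image. *)
Lemma esum_image_le (I : pointedType) (T : choiceType) (P : set I) (e : I -> T)
    (a : T -> \bar R) :
  \esum_(j in e @` P) a j <= \esum_(i in P) a (e i).
Proof.
have /choice[s sP] : forall j, exists i, (e @` P) j -> P i /\ e i = j.
  move=> j; have [[i Pi ei]|nj] := pselect ((e @` P) j); first by exists i.
  by exists point.
have sinj : set_inj (e @` P) s.
  move=> j j' /set_mem Pj /set_mem Pj' ss.
  by rewrite -(sP _ Pj).2 ss (sP _ Pj').2.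
rewrite (@eq_esum _ _ _ _ (fun j => a (e (s j)))) => [|j Pj]; last first.
  by rewrite (sP _ Pj).2.
rewrite -(esum_image _ _ (a \o e) sinj); apply: esum_sub => _ [j Pj <-].
exact: (sP _ Pj).1.
Qed.

Lemma esum_geometric (c r : R) : (0 <= c)%R -> (0 < r < 1)%R ->
  \esum_(n in [set: nat]) (c * r ^+ n)%:E < +oo.
Proof.
move=> c0 /andP[r0 r1].
have c0r n : 0 <= (c * r ^+ n)%:E by rewrite lee_fin mulr_ge0// exprn_ge0// ltW.
rewrite -nneseries_esumT//.
apply: (@le_lt_trans _ _ (c / (1 - r))%:E); last exact: ltry.
apply: lime_le; first exact: is_cvg_nneseries.
apply: nearW => n; rewrite sumEFin lee_fin.
by apply: geometric_le_lim => //; rewrite ger0_norm// ltW.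
Qed.

(** Generation n contributes 2 ^ n equal terms, whence a geometric series of
    ratio 2 * r. *)
Lemma esum_dyadic (c r : R) : (0 <= c)%R -> (0 < r)%R -> (2 * r < 1)%R ->
  \esum_(i in [set i : nat * nat | (i.2 < 2 ^ i.1)%N]) (c * r ^+ i.1)%:E < +oo.
Proof.
move=> c0 r0 r1.
have -> : [set i : nat * nat | (i.2 < 2 ^ i.1)%N] =
    [set: nat] `*`` (fun n => `I_(2 ^ n)).
  by apply/seteqP; split => [[n k]|[n k]] //= -[].
rewrite -(esum_esum (a := fun n _ => (c * r ^+ n)%:E)); last first.
  by move=> n _ _ _; rewrite lee_fin mulr_ge0// exprn_ge0// ltW.
apply: le_lt_trans (esum_geometric (r := 2 * r) c0 _); last by rewrite mulr_gt0.
apply: le_esum => n _; rewrite esum_fset//; last first.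
  by move=> k _; rewrite lee_fin mulr_ge0// exprn_ge0// ltW.
rewrite -fsbig_ord sumEFin sumr_const card_ord lee_fin.
by rewrite exprMn -natrX mulr_natl mulrnAr.
Qed.

End esum_extra.

Section circular_cantor_set.
Set Implicit Arguments.
Unset Strict Implicit.
Context {R : realType}.
Variable lam : R.
Hypotheses (lam0 : 0 < lam) (lam12 : lam < 1 / 2).

Definition circular_cantor : set R[i] := @expi R @` cantor_set lam.

Lemma circular_cantor_circle : circular_cantor `<=` @circle R.
Proof. by move=> _ [t _ <-]; exact: circle_expi. Qed.

Lemma circular_cantor_closed : closed circular_cantor.
Proof. by apply: expi_closed; exact: cantor_compact. Qed.

Lemma cantor_setE t : cantor_set lam t -> 0 <= t <= 1.
Proof. by move/(cantor_unit lam0 lam12); rewrite /= in_itv. Qed.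

Lemma cantor_set0 : cantor_set lam 0.
Proof. exact: (@cantor_cell_start _ lam lam0 lam12 0 0). Qed.

Lemma cantor_set1 : cantor_set lam 1.
Proof.
have := @cantor_cell_end _ lam lam0 lam12 0 0 isT.
by rewrite /= add0r.
Qed.

Lemma pi2_gt1 : 1 < 2 * pi :> R.
Proof. by have := pi_ge2 R; lra. Qed.

Lemma expi_notin_cantor t : 0 <= t < 2 * pi -> ~ cantor_set lam t ->
  ~ circular_cantor (expi t).
Proof.
move=> t2 nt [s Ks st]; apply: nt; rewrite -(expi_inj _ st)//.
by have := cantor_setE Ks; have := pi2_gt1; rewrite ltr_norml; lra.
Qed.

(** The Cantor set occupies angles in [0, 1] only, so that besides the gaps
    there is one more arc, from the angle 1 to the angle 2 * pi. *)
Lemma complementary_arcs_cantor :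
  complementary_arcs circular_cantor `<=`
  [set @expi R @` `]1, 2 * pi[] `|`
  (fun i : nat * nat => @expi R @` `]gap_lo lam i.1 i.2, gap_hi lam i.1 i.2[)
    @` [set i : nat * nat | (i.2 < 2 ^ i.1)%N].
Proof.
have p1 := pi2_gt1.
move=> _ [z [/circle_arg[t /andP[t0 t2] ->] nE] <-].
have nK : ~ cantor_set lam t by move=> Kt; apply: nE; exists t.
have [t1|t1] := leP t 1.
- right; have [|n [k [kn tnk]]] := cantor_compl lam0 lam12 _ nK; first by rewrite t0.
  exists (n, k) => //=; apply/esym.
  have g0 := cantor_setE (cantor_gap_lo lam0 lam12 kn).
  have g1 := cantor_setE (cantor_gap_hi lam0 lam12 kn).
  apply: component_arc.
  + by case/andP: g0.
  + exact: gap_lt.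
  + by case/andP: g1 => _ /le_trans; apply; exact: ltW.
  + exact: circular_cantor_circle.
  + by exists (gap_lo lam n k) => //; exact: cantor_gap_lo.
  + by exists (gap_hi lam n k) => //; exact: cantor_gap_hi.
  + move=> _ [s /= + <-]; rewrite in_itv/= => sg.
    apply: expi_notin_cantor; last exact: gap_cantor sg.
    by case/andP: sg g0 g1; lra.
  + by exists t => //=; rewrite in_itv.
- left => /=; apply: component_arc => //.
  + exact: circular_cantor_circle.
  + by exists 1 => //; exact: cantor_set1.
  + by exists 0; [exact: cantor_set0|rewrite -[in RHS](add0r (2 * pi)) expiD2pi].
  + move=> _ [s /= + <-]; rewrite in_itv/= => sg.
    apply: expi_notin_cantor; first by case/andP: sg; lra.
    by move/cantor_setE; case/andP: sg; lra.
  + by exists t => //=; rewrite in_itv/= t1.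
Qed.

Lemma arclength_arc a b : 0 <= a -> a < b -> b <= 2 * pi ->
  arclength (@expi R @` `]a, b[) = (b - a)%:E.
Proof.
move=> a0 ab b2; rewrite arclength_expi.
  by rewrite lebesgue_measure_itv/= lte_fin ab EFinB.
by move=> t /=; rewrite !in_itv/=; lra.
Qed.

(** The gaps of generation n have length comparable to lam ^ n, so the sum of
    their powers is dominated by a geometric series of ratio 2 * lam `^ alpha. *)
Lemma circular_cantor_carleson (alpha : R) : 0 < alpha -> 2 * lam `^ alpha < 1 ->
  beurling_carleson alpha circular_cantor.
Proof.
move=> al0 al1; split.
- exact: circular_cantor_closed.
- exact: circular_cantor_circle.
- rewrite arclength_expi ?cantor_null// => t /cantor_setE t01 /=.
  by rewrite in_itv/=; have := pi2_gt1; lra.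
set F := fun J : set R[i] => (arclength J `^ alpha)%E.
have F0 J : (0 <= F J)%E by exact: poweR_ge0.
set outer := [set @expi R @` `]1, 2 * pi[].
pose gap (i : nat * nat) := @expi R @` `]gap_lo lam i.1 i.2, gap_hi lam i.1 i.2[.
pose I := [set i : nat * nat | (i.2 < 2 ^ i.1)%N].
have gapE i : I i -> F (gap i) = ((1 - 2 * lam) `^ alpha * (lam `^ alpha) ^+ i.1)%:E.
  move=> Ii; have lo := cantor_setE (cantor_gap_lo lam0 lam12 Ii).
  have hi := cantor_setE (cantor_gap_hi lam0 lam12 Ii).
  have p1 := pi2_gt1.
  rewrite /F /gap arclength_arc; last 3 first.
  - by case/andP: lo.
  - exact: gap_lt.
  - by case/andP: hi => _ /le_trans; apply; exact: ltW.
  rewrite gap_size poweR_EFin powRM; last 2 first.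
  - by have := lam12; lra.
  - by rewrite exprn_ge0// ltW.
  by rewrite powR_exprn// ltW.
apply: le_lt_trans (esum_sub F complementary_arcs_cantor) _.
rewrite (esumID outer)//; apply: lte_add_pinfty.
  apply: (@le_lt_trans _ _ (\esum_(J in outer) F J)%E).
    by apply: esum_sub => J [].
  rewrite esum_set1// /F arclength_arc ?poweR_EFin ?ltry//.
  exact: pi2_gt1.
apply: (@le_lt_trans _ _ (\esum_(J in gap @` I) F J)%E).
  by apply: esum_sub => J [[|]].
apply: le_lt_trans (esum_image_le _ _ _) _.
rewrite (eq_esum gapE); apply: esum_dyadic => //; first exact: powR_ge0.
exact: powR_gt0.
Qed.

End circular_cantor_set.

(** * The Cantor measure on the circle *)

Section cantor_measure.
Set Implicit Arguments.
Unset Strict Implicit.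
Context {R : realType}.
Variable lam : R.
Hypotheses (lam0 : 0 < lam) (lam12 : lam < 1 / 2).

Lemma borelC_open (A : set R[i]) : open A -> measurable (A : set (borelC R)).
Proof. by move=> oA; exact: sub_sigma_algebra. Qed.

Lemma borelC_closed (A : set R[i]) : closed A -> measurable (A : set (borelC R)).
Proof.
move=> cA; rewrite -[A]setCK; apply: measurableC; apply: borelC_open.
exact: closed_openC.
Qed.

Lemma continuous_measurableC (f : R[i] -> R) : continuous f ->
  measurable_fun setT (f : borelC R -> R).
Proof.
move=> /continuousP cf; apply: (measurability _ (RGenOpens.measurableE R)).
move=> _ [_ [a [b ->]] <-]; rewrite setTI; apply: borelC_open; apply: cf.
exact: interval_open.
Qed.

Lemma measurable_expi : measurable_fun setT (@expi R : R -> borelC R).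
Proof.
apply: (@measurability _ _ R (borelC R) setT (@expi R) (@open R[i]) erefl).
move=> _ [A oA <-].
rewrite setTI; apply: open_measurable; move/continuousP: (@continuous_expi R).
exact.
Qed.

Let f : R -> borelC R := @expi R \o cantor_fun lam.

Let mf : measurable_fun setT f.
Proof.
apply: measurableT_comp; first exact: measurable_expi.
by apply: nondecreasing_measurable => //; exact: cantor_fun_le.
Qed.

(** The image of Lebesgue measure on [0, 1] under the parametrisation; the
    preimage of a cell of generation n lies in a dyadic interval. *)
Lemma cantor_measure_exists :
  exists mu : {finite_measure set (borelC R) -> \bar R},
  [/\ mu setT = 1%E, mu (~` circular_cantor lam) = 0%E &
      forall n k, (k < 2 ^ n)%N ->
        (mu (@expi R @` cell lam n k) <= (2 ^- n)%:E)%E].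
Proof.
pose P : probability _ R := uniform_prob (@ltr01 R).
have mf2 : measurable_fun setT (f : measurableTypeR R -> borelC R) by exact: mf.
pose X : {mfun measurableTypeR R >-> borelC R} :=
  @mfun_Sub _ _ (measurableTypeR R) (borelC R) f (mem_set mf2).
exists (distribution P X); split.
- exact: probability_setT.
- change (P (f @^-1` (~` circular_cantor lam)) = 0%E).
  rewrite (_ : _ @^-1` _ = set0) ?measure0//.
  by apply/seteqP; split => // t; apply; exists (cantor_fun lam t) => //; exact: cantor_funP.
- move=> n k kn.
have mE : measurable (@expi R @` cell lam n k : set (borelC R)).
  by apply: borelC_closed; apply: expi_closed; exact: segment_compact.
have mU : measurable (f @^-1` (@expi R @` cell lam n k)).
  by rewrite -[_ @^-1` _]setTI; exact: mf.
change (uniform_prob (@ltr01 R) (f @^-1` (@expi R @` cell lam n k)) <= (2 ^- n)%:E)%E.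
rewrite /uniform_prob integral_uniform_pdf.
rewrite (eq_integral (cst 1%E)); last first.
  by move=> x; rewrite inE/= in_itv/= /uniform_pdf => -[_ ->]; rewrite subr0 invr1.
rewrite integral_cst; last by apply: measurableI => //; exact: measurable_itv.
rewrite mul1e.
apply: (@le_trans _ _
  (lebesgue_measure (`[k%:R / 2 ^+ n, k.+1%:R / 2 ^+ n]%classic : set R))).
  apply: le_measure; rewrite ?inE.
  - by apply: measurableI => //; exact: measurable_itv.
  - exact: measurable_itv.
  - move=> t [[s scell st] t01].
    apply: (cantor_fun_preimage lam0 lam12 kn); split => //=.
    rewrite -(expi_inj _ st)//.
    have := cell_unit lam0 lam12 scell.
    have := cantor_unit lam0 lam12 (cantor_funP lam0 lam12 t).
    rewrite /= !in_itv/=.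
    by have := pi_ge2 R; rewrite ltr_norml; lra.
rewrite lebesgue_measure_itv/= lte_fin ltr_pM2r ?invr_gt0 ?exprn_gt0// ltr_nat ltnSn.
by rewrite -EFinB lee_fin -mulrBl -natrB// subSnn mul1r.
Qed.

End cantor_measure.

(** * Complex derivatives and the exponential *)

Section complex_derivative.
Set Implicit Arguments.
Unset Strict Implicit.
Context {R : realType}.
Implicit Types (f g : R[i] -> R[i]) (z w h l : R[i]).

(** Differentiability with an explicit remainder: kernel estimates give it
    directly, and it composes without any appeal to the topology of R[i]. *)
Definition has_cderiv f z l := forall e : R, 0 < e ->
  exists2 d : R, 0 < d & forall h, normc h < d ->
    normc (f (z + h) - f z - h * l) <= e * normc h.

Lemma has_cderiv_derive1 f z l : has_cderiv f z l -> derive1 f z = l.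
Proof.
move=> fl; apply: cvg_lim; first exact: norm_hausdorff.
move=> A /nbhs_normcP[e e0 eA].
have e20 : 0 < e / 2 by rewrite divr_gt0.
have [d d0 dP] := fl _ e20.
change (nbhs 0^' [set h | A (h^-1 *: (f (h + z) - f z))]).
apply/nbhs_normcP; exists d => // h; rewrite subr0 => hd hn0.
have nh : 0 < normc h by rewrite normc_gt0.
apply: eA; have -> : h^-1 *: (f (h + z) - f z) - l = h^-1 * (f (z + h) - f z - h * l).
  by rewrite [RHS]mulrBr mulrA mulVf// mul1r addrC [h + z]addrC addrC.
rewrite normcM normcV mulrC ltr_pdivrMr//.
by apply: le_lt_trans (dP _ hd) _; rewrite ltr_pM2r// ltr_pdivrMr// ltr_pMr// ltr1n.
Qed.

Lemma has_cderiv_comp f g z k l :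
  has_cderiv g z k -> has_cderiv f (g z) l ->
  has_cderiv (f \o g) z (k * l).
Proof.
move=> gk fl e e0.
have K0 : 0 < normc k + normc l + 2.
  by rewrite -addrA ltr_wpDl ?normc_ge0// ltr_wpDl ?normc_ge0.
set K := _ + _ in K0.
pose e1 := Num.min 1 (e / K).
have e10 : 0 < e1 by rewrite lt_min ltr01 divr_gt0.
have [d1 d10 d1P] := gk _ e10.
have [d2 d20 d2P] := fl _ e10.
exists (Num.min d1 (d2 / K)); first by rewrite lt_min d10 divr_gt0.
move=> h; rewrite lt_min => /andP[hd1 hd2] /=.
have := d1P _ hd1; set u := g (z + h) - g z => hu.
have nh := normc_ge0 h.
have e11 : e1 <= 1 by rewrite ge_min lexx.
have uK : normc u <= (normc k + 1) * normc h.
  have -> : u = (u - h * k) + h * k by rewrite subrK.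
  apply: (le_trans (le_normcD _ _)); rewrite mulrDl addrC lerD//.
    by rewrite normcM mulrC.
  by apply: (le_trans hu); rewrite ler_wpM2r.
have ud2 : normc u < d2.
  apply: (le_lt_trans uK); rewrite ltr_pdivlMr// in hd2.
  apply: le_lt_trans hd2; rewrite mulrC ler_wpM2l//.
  by have := normc_ge0 l; rewrite /K; lra.
have := d2P _ ud2; have -> : g z + u = g (z + h) by rewrite addrC subrK.
move=> hf.
have -> : f (g (z + h)) - f (g z) - h * (k * l) =
  (f (g (z + h)) - f (g z) - u * l) + (u - h * k) * l by ring.
apply: (le_trans (le_normcD _ _)); rewrite normcM.
have e1K : e1 * K <= e by rewrite -ler_pdivlMr// ge_min lexx orbT.
apply: (@le_trans _ _ (e1 * K * normc h)); last by rewrite ler_wpM2r.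
have hul : normc (u - h * k) * normc l <= e1 * normc h * normc l.
  by rewrite ler_wpM2r ?normc_ge0.
have e1u : e1 * normc u <= e1 * ((normc k + 1) * normc h) by rewrite ler_pM2l.
have : 0 <= e1 * normc h by rewrite mulr_ge0// ltW.
by rewrite /K; nra.
Qed.

Lemma has_cderivN f z l : has_cderiv f z l -> has_cderiv (fun w => - f w) z (- l).
Proof.
move=> fl e e0; have [d d0 dP] := fl _ e0; exists d => // h /dP.
have -> : - f (z + h) - - f z - h * - l = - (f (z + h) - f z - h * l) by ring.
by rewrite normcN.
Qed.

Lemma is_derive_approx (f : R -> R) (x df : R) : is_derive x 1 f df ->
  forall e : R, 0 < e -> exists2 d : R, 0 < d & forall h : R, `|h| < d ->
    `|f (x + h) - f x - h * df| <= e * `|h|.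
Proof.
move=> [fx <-] e e0; have /cvgr_dist_le/(_ _ e0) := fx.
move=> /nbhs_ballP[d /= d0 dP]; exists d => // h hd.
have [->|h0] := eqVneq h 0; first by rewrite addr0 subrr mul0r subrr normr0 mulr0.
have := dP h; rewrite -ball_normE /= sub0r normrN => /(_ hd h0).
rewrite -[_%:A]/(h * 1) mulr1 [h + x]addrC distrC => H.
have nh : 0 < `|h| by rewrite normr_gt0.
rewrite -ler_pdivrMr// -normfV -normrM mulrBl mulrAC divff// mul1r mulrC.
exact: H.
Qed.

Lemma cexpD z w : cexp (z + w) = cexp z * cexp w.
Proof.
case: z w => a b [c d]; rewrite /cexp /= expRD expiD.
by rewrite rmorphM /= mulrACA.
Qed.

Lemma normc_cexp z : normc (cexp z) = expR (complex.Re z).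
Proof.
rewrite /cexp normcM normc_expi mulr1 /= expr0n addr0 sqrtr_sqr ger0_norm ?expR_ge0//.
Qed.

(** Write exp(x + i y) - 1 - (x + i y) in terms of the remainders at 0 of the
    real exponential, of cos and of sin, each of which is o(|x|) or o(|y|). *)
Lemma has_cderiv_cexp0 : has_cderiv (@cexp R) 0 1.
Proof.
move=> e e0.
(* The real remainders add up to at most 6 e1 |h|. *)
pose e1 := Num.min 1 (e / 6).
have e10 : 0 < e1 by rewrite lt_min ltr01 divr_gt0.
have e11 : e1 <= 1 by rewrite ge_min lexx.
have e16 : 6 * e1 <= e by rewrite mulrC -ler_pdivlMr// ge_min lexx orbT.
have [d1 d10 H1] := is_derive_approx (is_derive_expR 0) e10.
have [d2 d20 H2] := is_derive_approx (is_derive_cos 0) e10.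
have [d3 d30 H3] := is_derive_approx (is_derive_sin 0) e10.
exists (Num.min (Num.min d1 (e1 / 2)) (Num.min d2 d3)).
  by rewrite !lt_min d10 d20 d30 divr_gt0.
move=> [x y] hd.
have : `|x| < _ := le_lt_trans (normc_Re (x +i* y)) hd.
have : `|y| < _ := le_lt_trans (normc_Im (x +i* y)) hd.
rewrite !lt_min => /andP[_ /andP[yd2 yd3]] /andP[/andP[xd1 xe] _].
have h1 := H1 _ xd1; have h2 := H2 _ yd2; have h3 := H3 _ yd3.
rewrite add0r expR0 mulr1 in h1; rewrite add0r cos0 sin0 oppr0 mulr0 subr0 in h2.
rewrite add0r cos0 sin0 mulr1 subr0 in h3.
rewrite [X in normc X](_ : _ =
  (expR x * (cos y - 1) + (expR x - 1 - x)) +i*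
  (expR x * (sin y - y) + (expR x - 1) * y)); last first.
  rewrite add0r mulr1 /cexp /= expR0 /expi cos0 sin0.
  by apply/eqP; rewrite eq_complex /=; apply/andP; split; apply/eqP; ring.
apply: (le_trans (normc_leD _ _)).
have nx := normc_Re (x +i* y); have ny := normc_Im (x +i* y).
rewrite -/(normc (x +i* y)); set n := normc _ in nx ny *; rewrite /= in nx ny.
apply: (@le_trans _ _ (6 * e1 * n)); last by rewrite ler_wpM2r// (le_trans _ nx).
have ex2 : expR x <= 2.
  have : expR x - 1 - x <= e1 * `|x| by apply: le_trans (ler_norm _) h1.
  have := ler_norm x; have := normr_ge0 x; nra.
have ex1 : `|expR x - 1| <= e1.
  have -> : expR x - 1 = (expR x - 1 - x) + x by ring.
  apply: (le_trans (ler_normD _ _)); have := normr_ge0 x; nra.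
have ex0 := expR_ge0 x.
apply: (@le_trans _ _ ((2 * (e1 * `|y|) + e1 * `|x|) + (2 * (e1 * `|y|) + e1 * `|y|))).
  apply: lerD; apply: (le_trans (ler_normD _ _)); rewrite !normrM (ger0_norm ex0).
    by apply: lerD => //; apply: ler_pM.
  by apply: lerD; [apply: ler_pM|rewrite ler_wpM2r].
have := normr_ge0 y; have := normr_ge0 x; nra.
Qed.

(** The functional equation transports the derivative from 0 to z. *)
Lemma has_cderiv_cexp z : has_cderiv (@cexp R) z (cexp z).
Proof.
move=> e e0; have E0 := expR_gt0 (complex.Re z).
have [|d d0 dP] := has_cderiv_cexp0 (e := e / expR (complex.Re z)).
  by rewrite divr_gt0.
exists d => // h /dP; rewrite add0r mulr1.
have -> : cexp 0 = 1 :> R[i].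
  rewrite /cexp /= expR0 /expi cos0 sin0; apply/eqP.
  by rewrite eq_complex /= !mulr1 !mulr0 subr0 addr0 !eqxx.
move=> H; have -> : cexp (z + h) - cexp z - h * cexp z = cexp z * (cexp h - 1 - h).
  by rewrite cexpD; ring.
rewrite normcM normc_cexp mulrC; rewrite mulrAC in H.
by rewrite -ler_pdivlMr.
Qed.

End complex_derivative.

(** * Complex integrals over the circle *)

Section circle_integral.
Set Implicit Arguments.
Unset Strict Implicit.
Context {R : realType}.
Implicit Types (f g : R[i] -> R[i]) (z w h c : R[i]).

Definition cmeasurable f :=
  measurable_fun setT (fun w : borelC R => complex.Re (f w)) /\
  measurable_fun setT (fun w : borelC R => complex.Im (f w)).

Lemma cmeasurable_cst c : cmeasurable (fun=> c).
Proof. by split; exact: measurable_cst. Qed.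

Lemma cmeasurable_id : cmeasurable id.
Proof.
by split; apply: continuous_measurableC; [exact: continuous_Re|exact: continuous_Im].
Qed.

Lemma cmeasurableD f g : cmeasurable f -> cmeasurable g ->
  cmeasurable (fun w => f w + g w).
Proof.
move=> [f1 f2] [g1 g2]; split.
- rewrite (_ : (fun _ => _) = (fun w => complex.Re (f w) + complex.Re (g w))).
    exact: measurable_funD.
  by apply/funext => w; case: (f w) (g w) => ? ? [].
- rewrite (_ : (fun _ => _) = (fun w => complex.Im (f w) + complex.Im (g w))).
    exact: measurable_funD.
  by apply/funext => w; case: (f w) (g w) => ? ? [].
Qed.

Lemma cmeasurableM f g : cmeasurable f -> cmeasurable g ->
  cmeasurable (fun w => f w * g w).
Proof.
move=> [f1 f2] [g1 g2]; split.
- rewrite (_ : (fun _ => _) = (fun w => complex.Re (f w) * complex.Re (g w) -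
    complex.Im (f w) * complex.Im (g w))).
    by apply: measurable_funB; exact: measurable_funM.
  by apply/funext => w; case: (f w) (g w) => ? ? [].
- rewrite (_ : (fun _ => _) = (fun w => complex.Re (f w) * complex.Im (g w) +
    complex.Im (f w) * complex.Re (g w))).
    by apply: measurable_funD; exact: measurable_funM.
  by apply/funext => w; case: (f w) (g w) => ? ? [].
Qed.

(** The real and imaginary parts of 1/f are those of the conjugate of f divided
    by |f|^2; the reciprocal is measurable as the real power of exponent -1. *)
Lemma cmeasurableV f : cmeasurable f -> cmeasurable (fun w => (f w)^-1).
Proof.
move=> [f1 f2].
pose n2 w := (complex.Re (f w) ^+ 2 + complex.Im (f w) ^+ 2) `^ (-1).
have n2E w : n2 w = (complex.Re (f w) ^+ 2 + complex.Im (f w) ^+ 2)^-1.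
  by rewrite /n2 powR_inv1// addr_ge0// sqr_ge0.
have mn2 : measurable_fun setT (n2 : borelC R -> R).
  apply: (@measurableT_comp _ _ _ _ _ _ (fun x : R => x `^ (-1))).
    exact: measurable_powR.
  by apply: measurable_funD; exact: measurable_funX.
split.
- rewrite (_ : (fun _ => _) = (fun w => complex.Re (f w) * n2 w)).
    exact: measurable_funM.
  by apply/funext => w; rewrite n2E; case: (f w).
- rewrite (_ : (fun _ => _) = (fun w => - complex.Im (f w) * n2 w)).
    by apply: measurable_funM => //; exact: measurable_funN.
  by apply/funext => w; rewrite n2E; case: (f w) => a b /=; rewrite mulNr.
Qed.

Lemma measurable_circle : measurable (@circle R : set (borelC R)).
Proof.
apply: borelC_closed; rewrite (_ : @circle R = @expi R @` `[0, 2 * pi]).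
  by apply: expi_closed; exact: segment_compact.
apply/seteqP; split => [z /circle_arg[t /andP[t0 t1] ->]|_ [t _ <-]].
  by exists t => //=; rewrite in_itv/= t0 ltW.
exact: circle_expi.
Qed.

Variable nu : {measure set (borelC R) -> \bar R}.
Hypothesis nuT : (nu setT < +oo)%E.

Lemma measure_lty (A : set (borelC R)) : measurable A -> (nu A < +oo)%E.
Proof. by move=> mA; apply: le_lt_trans nuT; apply: le_measure; rewrite ?inE. Qed.

(** The class on which the integral over the circle is additive, homogeneous
    and controlled by the bound M. *)
Definition cbounded f (M : R) :=
  cmeasurable f /\ forall w, circle w -> normc (f w) <= M.

Lemma bounded_integrable (g : R[i] -> R) (M : R) :
  measurable_fun setT (g : borelC R -> R) -> (forall w, circle w -> `|g w| <= M) ->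
  nu.-integrable (@circle R) (EFin \o g).
Proof.
move=> mg gM; apply: measurable_bounded_integrable.
- exact: measurable_circle.
- exact: measure_lty measurable_circle.
- exact: measurable_funS mg.
- exists M; split; first exact: num_real.
  by move=> x Mx w cw /=; apply: le_trans (ltW Mx); exact: gM.
Qed.

Lemma cbounded_Re f M : cbounded f M ->
  nu.-integrable (@circle R) (EFin \o (fun w => complex.Re (f w))).
Proof.
move=> [[f1 _] fM]; apply: (bounded_integrable (M := M)) f1 _ => w /fM.
exact: le_trans (normc_Re _).
Qed.

Lemma cbounded_Im f M : cbounded f M ->
  nu.-integrable (@circle R) (EFin \o (fun w => complex.Im (f w))).
Proof.
move=> [[_ f2] fM]; apply: (bounded_integrable (M := M)) f2 _ => w /fM.
exact: le_trans (normc_Im _).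
Qed.

Let cint f := cintegral nu (@circle R) f.

Lemma eq_cintegral f g : (forall w, circle w -> f w = g w) -> cint f = cint g.
Proof.
move=> fg; rewrite /cint /cintegral.
by congr (_ +i* _); apply: eq_Rintegral => w /set_mem cw; rewrite fg.
Qed.

Lemma cintegralD f g M N : cbounded f M -> cbounded g N ->
  cint (fun w => f w + g w) = cint f + cint g.
Proof.
move=> fM gN; rewrite /cint /cintegral.
have mC := measurable_circle.
rewrite (_ : _ + _ = (\int[nu]_(w in @circle R) complex.Re (f w) +
    \int[nu]_(w in @circle R) complex.Re (g w)) +i*
    (\int[nu]_(w in @circle R) complex.Im (f w) +
    \int[nu]_(w in @circle R) complex.Im (g w)))//.
rewrite -(RintegralD mC (cbounded_Re fM) (cbounded_Re gN)).
rewrite -(RintegralD mC (cbounded_Im fM) (cbounded_Im gN)).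
by congr (_ +i* _); apply: eq_Rintegral => w _; case: (f w) (g w) => ? ? [].
Qed.

Lemma cintegralZ c f M : cbounded f M -> cint (fun w => c * f w) = c * cint f.
Proof.
move=> fM; rewrite /cint /cintegral.
have mC := measurable_circle.
have iR := cbounded_Re fM; have iI := cbounded_Im fM.
case: c => a b.
have int1 (x : R) (g : R[i] -> R) : nu.-integrable (@circle R) (EFin \o g) ->
    nu.-integrable (@circle R) (EFin \o (fun w => x * g w)).
  by move=> ig; have := integrableZl mC x ig; apply: eq_integrable.
rewrite [RHS](_ : _ =
  (a * \int[nu]_(w in @circle R) complex.Re (f w) -
   b * \int[nu]_(w in @circle R) complex.Im (f w)) +i*
  (a * \int[nu]_(w in @circle R) complex.Im (f w) +
   b * \int[nu]_(w in @circle R) complex.Re (f w)))//.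
rewrite -!(RintegralZl _ mC)//.
rewrite -(RintegralB mC (int1 a _ iR) (int1 b _ iI)).
rewrite -(RintegralD mC (int1 a _ iI) (int1 b _ iR)).
by congr (_ +i* _); apply: eq_Rintegral => w _; case: (f w) => ? ?.
Qed.

Lemma Rintegral_bound (g : R[i] -> R) (M : R) :
  measurable_fun setT (g : borelC R -> R) -> (forall w, circle w -> `|g w| <= M) ->
  `|\int[nu]_(w in @circle R) g w| <= M * fine (nu (@circle R)).
Proof.
move=> mg gM; have mC := measurable_circle.
have ig := bounded_integrable mg gM.
apply: (le_trans (le_normr_Rintegral mC ig)).
rewrite -Rintegral_cst//; apply: le_Rintegral => //.
- apply: (bounded_integrable (M := M)) => [|w /gM]; last by rewrite normr_id.
  exact: measurableT_comp.
- apply: (bounded_integrable (M := `|M|)) => //.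
Qed.

Lemma cintegral_bound f M : cbounded f M ->
  normc (cint f) <= 2 * M * fine (nu (@circle R)).
Proof.
move=> [[f1 f2] fM]; apply: (le_trans (normc_leD _ _)).
rewrite -mulrA mulr2n mulrDl mul1r; apply: lerD.
- by apply: Rintegral_bound => // w /fM; exact: le_trans (normc_Re _).
- by apply: Rintegral_bound => // w /fM; exact: le_trans (normc_Im _).
Qed.

End circle_integral.

(** * The derivative of a singular inner function *)

Section singular_inner_derivative.
Set Implicit Arguments.
Unset Strict Implicit.
Context {R : realType}.
Implicit Types (z w h : R[i]).
Variable nu : {measure set (borelC R) -> \bar R}.
Hypothesis nuT : (nu setT < +oo)%E.

Lemma normc_leB z w : normc w - normc z <= normc (w - z).
Proof.
rewrite lerBlDr -[leLHS](_ : normc (w - z + z) = _); last by rewrite subrK.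
exact: le_normcD.
Qed.

Lemma circle_dist z w : circle w -> 1 - normc z <= normc (w - z).
Proof. by move=> /circleP <-; exact: normc_leB. Qed.

Lemma circle_neq z w : normc z < 1 -> circle w -> w - z != 0.
Proof.
move=> z1 cw; rewrite -normc_gt0; apply: lt_le_trans (circle_dist z cw).
by rewrite subr_gt0.
Qed.

Lemma normc_exprn z n : normc (z ^+ n) = normc z ^+ n.
Proof.
elim: n => [|n IH]; first by rewrite !expr0 normc1.
by rewrite !exprS normcM IH.
Qed.

Lemma cmeasurableB_cst z : cmeasurable (fun w => w - z).
Proof. exact: cmeasurableD cmeasurable_id (cmeasurable_cst _). Qed.

Lemma herglotz_cbounded z : normc z < 1 ->
  cbounded (fun w => (w + z) / (w - z)) (2 / (1 - normc z)).
Proof.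
move=> z1; split.
  apply: cmeasurableM; first exact: cmeasurableD cmeasurable_id (cmeasurable_cst _).
  exact: cmeasurableV (cmeasurableB_cst z).
move=> w cw; rewrite normcM normcV; apply: ler_pM; rewrite ?invr_ge0 ?normc_ge0//.
  apply: (le_trans (le_normcD _ _)); move/circleP: cw => ->; lra.
by rewrite lef_pV2 ?posrE ?normc_gt0 ?circle_neq// ?subr_gt0// circle_dist.
Qed.

Lemma cmeasurable_dherglotz z : cmeasurable (fun w => 2 * w / (w - z) ^+ 2).
Proof.
apply: cmeasurableM.
  by apply: cmeasurableM; [exact: cmeasurable_cst|exact: cmeasurable_id].
apply: cmeasurableV; apply: cmeasurableM; exact: cmeasurableB_cst.
Qed.

Lemma normc2 : normc (2 : R[i]) = 2.
Proof.
have -> : 2 = (2 : R)%:C :> R[i] by rewrite rmorph_nat.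
by rewrite /= expr0n addr0 sqrtr_sqr ger0_norm.
Qed.

Lemma dherglotz_bound z w : normc z < 1 -> circle w ->
  normc (2 * w / (w - z) ^+ 2) <= 2 / (1 - normc z) ^+ 2.
Proof.
move=> z1 cw; rewrite normcM normcV normcM normc2 normc_exprn.
have d0 : 0 < 1 - normc z by rewrite subr_gt0.
move/circleP: (cw) => ->; rewrite mulr1 ler_pM2l//.
rewrite lef_pV2 ?posrE ?exprn_gt0 ?normc_gt0 ?circle_neq//.
by rewrite ler_pXn2r ?nnegrE ?normc_ge0 ?(ltW d0) ?circle_dist.
Qed.

Lemma dherglotz_cbounded z : normc z < 1 ->
  cbounded (fun w => 2 * w / (w - z) ^+ 2) (2 / (1 - normc z) ^+ 2).
Proof.
by move=> z1; split; [exact: cmeasurable_dherglotz|move=> w; exact: dherglotz_bound].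
Qed.

Definition herglotz z : R[i] := cintegral nu (@circle R) (fun w => (w + z) / (w - z)).

Definition dherglotz z : R[i] :=
  cintegral nu (@circle R) (fun w => 2 * w / (w - z) ^+ 2).

(** The second order remainder of the Herglotz kernel is
    2 w h^2 / ((w - z)^2 (w - z - h)), which is bounded by a multiple of |h|^2
    uniformly for w on the circle. *)
Lemma has_cderiv_herglotz z : normc z < 1 -> has_cderiv herglotz z (dherglotz z).
Proof.
move=> z1 e e0.
have d0 : 0 < 1 - normc z by rewrite subr_gt0.
set d := 1 - normc z in d0.
set V := fine (nu (@circle R)).
have V0 : 0 <= V by apply: fine_ge0; exact: measure_ge0.
(* On the circle |w - z| >= d, and |w - z - h| >= d / 2 once |h| < d / 2. *)
pose C := 8 / d ^+ 3 * V.
have C0 : 0 <= C by rewrite mulr_ge0// divr_ge0// exprn_ge0// ltW.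
exists (Num.min (d / 2) (e / (C + 1))).
  by rewrite lt_min !divr_gt0// ltr_wpDl.
move=> h; rewrite lt_min => /andP[hd hC].
have zh1 : normc (z + h) < 1.
  by apply: (le_lt_trans (le_normcD _ _)); move: hd; rewrite /d; lra.
pose rho w := 2 * h ^+ 2 * (w * ((w - z) ^+ 2)^-1 * (w - (z + h))^-1).
have d2 : d / 2 <= 1 - normc (z + h).
  by have := le_normcD z h; move: hd; rewrite /d; lra.
have brho : cbounded rho (4 * normc h ^+ 2 / d ^+ 3).
  split.
    apply: cmeasurableM; first exact: cmeasurable_cst.
    apply: cmeasurableM; last exact: cmeasurableV (cmeasurableB_cst _).
    apply: cmeasurableM; first exact: cmeasurable_id.
    by apply: cmeasurableV; apply: cmeasurableM; exact: cmeasurableB_cst.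
  move=> w cw; rewrite /rho !normcM !normcV !normc_exprn normc2.
  move/circleP: (cw) => ->; rewrite mul1r.
  have -> : 4 * normc h ^+ 2 / d ^+ 3 = 2 * normc h ^+ 2 * ((d ^+ 2)^-1 * (d / 2)^-1).
    by field; rewrite gt_eqF.
  rewrite ler_wpM2l ?mulr_ge0 ?exprn_ge0 ?normc_ge0//.
  apply: ler_pM; rewrite ?invr_ge0 ?exprn_ge0 ?normc_ge0//.
    rewrite lef_pV2 ?posrE ?exprn_gt0 ?normc_gt0 ?circle_neq//.
    by rewrite ler_pXn2r ?nnegrE ?normc_ge0 ?(ltW d0) ?circle_dist.
  rewrite lef_pV2 ?posrE ?normc_gt0 ?circle_neq ?divr_gt0//.
  exact: le_trans d2 (circle_dist _ cw).
have bK := herglotz_cbounded z1.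
have bG := dherglotz_cbounded z1.
have bhG : cbounded (fun w => h * (2 * w / (w - z) ^+ 2)) (normc h * (2 / d ^+ 2)).
  split; first exact: cmeasurableM (cmeasurable_cst _) bG.1.
  by move=> w cw; rewrite normcM ler_wpM2l ?normc_ge0 ?bG.2.
have bK' : cbounded (fun w => (w + z) / (w - z) + h * (2 * w / (w - z) ^+ 2))
    (2 / d + normc h * (2 / d ^+ 2)).
  split; first exact: cmeasurableD bK.1 bhG.1.
  by move=> w cw; apply: (le_trans (le_normcD _ _)); rewrite lerD ?bK.2 ?bhG.2.
have -> : herglotz (z + h) - herglotz z - h * dherglotz z = cintegral nu (@circle R) rho.
  rewrite /dherglotz -(cintegralZ nuT h bG) /herglotz.
  rewrite (@eq_cintegral _ nu (fun w => (w + (z + h)) / (w - (z + h)))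
    (fun w => ((w + z) / (w - z) + h * (2 * w / (w - z) ^+ 2)) + rho w)).
    rewrite (cintegralD nuT bK' brho) (cintegralD nuT bK bhG).
    by rewrite -addrA -opprD addrAC subrr add0r.
  move=> w cw; rewrite /rho; field.
  by rewrite circle_neq ?circle_neq.
apply: (le_trans (cintegral_bound nuT brho)); rewrite -/V.
rewrite (_ : 2 * _ * V = C * normc h * normc h); last by rewrite /C; ring.
rewrite ler_wpM2r ?normc_ge0//.
move: hC; rewrite ltr_pdivlMr ?ltr_wpDl// => hC.
by have := normc_ge0 h; lra.
Qed.

Lemma singular_inner_derive1 z : normc z < 1 ->
  derive1 (singular_inner nu) z = - dherglotz z * singular_inner nu z.
Proof.
move=> z1; apply: has_cderiv_derive1.
apply: (@has_cderiv_comp _ (@cexp R) (fun z => - herglotz z)).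
  exact: has_cderivN (has_cderiv_herglotz z1).
exact: has_cderiv_cexp.
Qed.

End singular_inner_derivative.

(** * The kernels near a boundary point off the support *)

Section kernel_bounds.
Set Implicit Arguments.
Unset Strict Implicit.
Context {R : realType}.
Implicit Types (r s t x y : R) (z w : R[i]).

Lemma abs_sin_le y : `|sin y| <= `|y|.
Proof.
wlog y0 : y / 0 <= y => [H|].
  have [/H//|y0] := leP 0 y.
  by rewrite -normrN -sinN -[leRHS]normrN; apply: H; rewrite oppr_ge0 ltW.
have [c _] := @MVT_segment _ sin cos 0 y y0 (fun x _ => is_derive_sin x)
  (continuous_subspaceT (@continuous_sin R)).
rewrite sin0 !subr0 => ->; rewrite normrM ler_piMl//.
exact: cos_max.
Qed.

(** The squared distance between two points of the circle whose angles differ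
    by y. *)
Definition chord2 y : R := 2 - 2 * cos y.

Lemma chord2_le y : chord2 y <= y ^+ 2.
Proof.
have h : sin (y / 2) ^+ 2 <= (y / 2) ^+ 2.
  rewrite -[leLHS]real_normK ?num_real// -[leRHS]real_normK ?num_real//.
  by rewrite ler_pXn2r ?nnegrE ?abs_sin_le.
have -> : y ^+ 2 = 4 * (y / 2) ^+ 2 by field.
have -> : chord2 y = 4 * sin (y / 2) ^+ 2.
  have -> : chord2 y = chord2 ((y / 2) *+ 2) by rewrite -mulr_natr divfK.
  by rewrite /chord2 cos_mulr2n cos2sin2; ring.
by rewrite ler_pM2l.
Qed.

Lemma chord2_le4 y : chord2 y <= 4.
Proof. by rewrite /chord2; have := cos_geN1 y; lra. Qed.

Lemma chord2_abs y : chord2 `|y| = chord2 y.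
Proof. by rewrite /chord2 cos_norm. Qed.

Lemma chord2_lt x y : 0 <= x -> x < y -> y <= pi -> chord2 x < chord2 y.
Proof.
move=> x0 xy yp; rewrite /chord2 ltrD2l ltrN2 ltr_pM2l//.
by rewrite ltr_cos// in_itv/=; lra.
Qed.

Lemma chord2_ge x y : 0 <= x -> x <= `|y| -> `|y| <= pi -> chord2 x <= chord2 y.
Proof.
move=> x0; rewrite -[chord2 y]chord2_abs le_eqVlt => /predU1P[->//|xy yp].
exact/ltW/chord2_lt.
Qed.

Lemma chord2_gt0 y : 0 < y -> y <= pi -> 0 < chord2 y.
Proof.
move=> y0 yp; rewrite (_ : 0 = chord2 0); first exact: chord2_lt.
by rewrite /chord2 cos0 mulr1 subrr.
Qed.

Lemma expi_neq0 t : expi t != 0 :> R[i].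
Proof. by rewrite -normc_gt0 normc_expi. Qed.

(** The real part is the Poisson kernel (1 - r^2) / |w - z|^2, and |w - z|^2 is
    at least r times the squared chord.  After a rotation only the angle s - t
    between the boundary point and the radius matters. *)
Lemma poisson_kernel_le r s t : 0 <= r -> 8 * (1 - r) <= chord2 (s - t) ->
  0 < chord2 (s - t) -> r < 1 ->
  complex.Re ((expi s + r%:C * expi t) / (expi s - r%:C * expi t)) <= 1 / 2.
Proof.
move=> r0 hr x0 r1; have x4 := chord2_le4 (s - t).
set u := expi (s - t); have us : expi s = u * expi t by rewrite -expiD subrK.
have u0 : u - r%:C != 0.
  apply/eqP => /subr0_eq ur; have := normc_expi (s - t); rewrite -/u ur /=.
  by rewrite expr0n addr0 sqrtr_sqr ger0_norm//; lra.
have -> : (expi s + r%:C * expi t) / (expi s - r%:C * expi t) =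
    (u + r%:C) / (u - r%:C).
  by rewrite us -mulrDl -mulrBl invfM mulrACA divff ?mulr1// expi_neq0.
have := cos2Dsin2 (s - t); move: x0 hr x4; rewrite /chord2 /u /expi /=.
set c := cos (s - t); set i := sin (s - t) => x0 hr x4 ci.
rewrite !addr0 oppr0 addr0.
have mE : (c - r) ^+ 2 + i ^+ 2 = (1 - r) ^+ 2 + r * (2 - 2 * c).
  by rewrite (_ : i ^+ 2 = 1 - c ^+ 2); [ring|lra].
have m0 : 0 < (1 - r) ^+ 2 + r * (2 - 2 * c).
  by rewrite addrC ltr_wpDl ?exprn_gt0 ?subr_gt0// mulr_ge0// ltW.
rewrite mE; set m := (1 - r) ^+ 2 + r * (2 - 2 * c) in m0 *.
rewrite [leLHS](_ : _ = (1 - r ^+ 2) / m); last first.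
  rewrite mulrN opprK !mulrA -mulrDl; congr (_ / _).
  by rewrite (_ : i * i = 1 - c ^+ 2); [ring|move: ci; rewrite !expr2; lra].
rewrite ler_pdivrMr// /m.
nra.
Qed.

(** At r = 1 the kernel times exp(i t) is exactly - 2 / |w - exp(i t)|^2; the
    hypothesis on 1 - r keeps its real part comparable to that value. *)
Lemma dherglotz_kernel_ge r s t : 0 <= r -> 8 * (1 - r) <= chord2 (s - t) ->
  0 < chord2 (s - t) -> r < 1 ->
  8 / (25 * chord2 (s - t)) <=
  - complex.Re (expi t * (2 * expi s / (expi s - r%:C * expi t) ^+ 2)).
Proof.
move=> r0 hr x0 r1; have x4 := chord2_le4 (s - t).
set u := expi (s - t); have us : expi s = u * expi t by rewrite -expiD subrK.
have u0 : u - r%:C != 0.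
  apply/eqP => /subr0_eq ur; have := normc_expi (s - t); rewrite -/u ur /=.
  by rewrite expr0n addr0 sqrtr_sqr ger0_norm//; lra.
have -> : expi t * (2 * expi s / (expi s - r%:C * expi t) ^+ 2) =
    2%:R%:C * (u * ((u - r%:C)^-1 * (u - r%:C)^-1)).
  rewrite us rmorph_nat; field.
  by rewrite u0 -mulrBl mulf_neq0 ?expi_neq0.
have := cos2Dsin2 (s - t); move: x0 hr x4; rewrite /chord2 /u /expi /=.
set c := cos (s - t); set i := sin (s - t) => x0 hr x4 ci.
rewrite !oppr0 !addr0 !mul0r !subr0.
have mE : (c - r) ^+ 2 + i ^+ 2 = (1 - r) ^+ 2 + r * (2 - 2 * c).
  by rewrite (_ : i ^+ 2 = 1 - c ^+ 2); [ring|lra].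
have m0 : 0 < (1 - r) ^+ 2 + r * (2 - 2 * c).
  by rewrite addrC ltr_wpDl ?exprn_gt0 ?subr_gt0// mulr_ge0// ltW.
rewrite mE; set m := (1 - r) ^+ 2 + r * (2 - 2 * c) in m0 mE *.
rewrite [leRHS](_ : _ = 2 * (2 * r - c * (1 + r ^+ 2)) / m ^+ 2); last first.
  transitivity (- 2 * (c * (c - r) ^+ 2 + i ^+ 2 * (c - 2 * r)) / m ^+ 2).
    by field; rewrite gt_eqF.
  by congr (_ / _); rewrite (_ : i ^+ 2 = 1 - c ^+ 2); [ring|lra].
have mx : m <= 5 / 4 * (2 - 2 * c) by rewrite /m; nra.
have nx : (2 - 2 * c) / 4 <= 2 * r - c * (1 + r ^+ 2) by nra.
rewrite ler_pdivlMr ?exprn_gt0// mulrAC ler_pdivrMr ?mulr_gt0//.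
have : m ^+ 2 <= (5 / 4 * (2 - 2 * c)) ^+ 2.
  by rewrite ler_pXn2r ?nnegrE// ?ltW// mulr_gt0.
nra.
Qed.

End kernel_bounds.

(** * The derivative of the inner function over the gaps *)

Section derivative_on_gaps.
Set Implicit Arguments.
Unset Strict Implicit.
Context {R : realType}.
Variable lam : R.
Hypotheses (lam0 : 0 < lam) (lam12 : lam < 1 / 2).
Variable nu : {measure set (borelC R) -> \bar R}.
Hypothesis nuT : (nu setT <= 1)%E.
Hypothesis nuE : nu (~` circular_cantor lam) = 0%E.
Implicit Types (n k : nat) (t : R) (g : R[i] -> R).

Notation E := (circular_cantor lam).

Let nuTfin : (nu setT < +oo)%E. Proof. exact: le_lt_trans nuT (ltry _). Qed.

Lemma measurable_circular_cantor : measurable (E : set (borelC R)).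
Proof. by apply: borelC_closed; exact: circular_cantor_closed. Qed.

(** nu is carried by the Cantor set, where the kernel bounds hold. *)
Lemma Rintegral_support g M : measurable_fun setT (g : borelC R -> R) ->
  (forall w, circle w -> `|g w| <= M) ->
  \int[nu]_(w in @circle R) g w = \int[nu]_(w in E) g w.
Proof.
move=> mg gM; rewrite /Rintegral.
have mC := @measurable_circle R; have mE := measurable_circular_cantor.
rewrite (negligible_integral (N := (@circle R `\` E : set (borelC R))) _ mC
  (bounded_integrable nuTfin mg gM)).
- congr (fine (integral _ _ _)); rewrite setDD; apply/setIidr.
  exact: circular_cantor_circle.
- exact: measurableD.
- apply/eqP; rewrite eq_le measure_ge0 andbT -nuE; apply: le_measure; rewrite ?inE.
  + exact: measurableD.
  + exact: measurableC.
  + by move=> w [].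
Qed.

Lemma integrable_support g M : measurable_fun setT (g : borelC R -> R) ->
  (forall w, circle w -> `|g w| <= M) -> nu.-integrable E (EFin \o g).
Proof.
move=> mg gM; apply: (integrableS (@measurable_circle R)).
- exact: measurable_circular_cantor.
- exact: circular_cantor_circle.
- exact: bounded_integrable mg gM.
Qed.

Lemma fine_nu_le1 (A : set (borelC R)) : measurable A -> fine (nu A) <= 1.
Proof.
move=> mA; rewrite -lee_fin fineK ?ge0_fin_numE ?measure_ge0//.
  by apply: le_trans nuT; apply: le_measure; rewrite ?inE.
exact: measure_lty.
Qed.

Lemma Rintegral_support_le g M c : measurable_fun setT (g : borelC R -> R) ->
  (forall w, circle w -> `|g w| <= M) -> 0 <= c -> (forall w, E w -> g w <= c) ->
  \int[nu]_(w in @circle R) g w <= c.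
Proof.
move=> mg gM c0 gc; rewrite (Rintegral_support mg gM).
have mE := measurable_circular_cantor.
apply: (@le_trans _ _ (\int[nu]_(w in E) (cst c w))).
  apply: le_Rintegral => //; first exact: integrable_support mg gM.
  by apply: (@integrable_support _ `|c|) => //; exact: measurable_cst.
by rewrite Rintegral_cst// ler_piMr// fine_nu_le1.
Qed.

Lemma Rintegral_support_ge g M c (B : set (borelC R)) :
  measurable_fun setT (g : borelC R -> R) ->
  (forall w, circle w -> `|g w| <= M) ->
  measurable B -> B `<=` E ->
  (forall w, E w -> 0 <= g w) -> (forall w, B w -> c <= g w) ->
  c * fine (nu B) <= \int[nu]_(w in @circle R) g w.
Proof.
move=> mg gM mB BE g0 gc; rewrite (Rintegral_support mg gM).
have mE := measurable_circular_cantor.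
have ig := integrable_support mg gM.
have igB : nu.-integrable B (EFin \o g) by exact: integrableS ig.
rewrite -(setDUK BE) Rintegral_setU//; last 3 first.
- exact: measurableD.
- by rewrite setDUK.
- by apply/disj_setPS => w [? []].
apply: (@le_trans _ _ (\int[nu]_(w in B) g w)); last first.
  by rewrite lerDl; apply: Rintegral_ge0 => w [Ew _]; exact: g0.
rewrite -Rintegral_cst//; apply: le_Rintegral => //.
apply: (integrableS mE) => //.
by apply: (@integrable_support (cst c) `|c|) => //; exact: measurable_cst.
Qed.

Definition gap_length n : R := (1 - 2 * lam) * lam ^+ n.

Definition gap_middle n k : set R :=
  `[gap_lo lam n k + gap_length n / 3, gap_hi lam n k - gap_length n / 3]%classic.

(** The gap to 1 is an eighth of the least squared chord from the middle third
    of a gap of generation n to the Cantor set, as the kernel bounds require. *)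
Definition radius n : R := 1 - chord2 (gap_length n / 3) / 8.

Lemma gap_length_gt0 n : 0 < gap_length n.
Proof. by rewrite mulr_gt0 ?exprn_gt0//; have := lam12; lra. Qed.

Lemma gap_length_le1 n : gap_length n <= 1.
Proof.
have l0 := lam0; have l1 := lam12.
by rewrite /gap_length mulr_ile1 ?exprn_ge0 ?exprn_ile1//; lra.
Qed.

Lemma radiusP n : [/\ 0 <= radius n, radius n < 1 &
  8 * (1 - radius n) = chord2 (gap_length n / 3)].
Proof.
have g0 := gap_length_gt0 n; have g1 := gap_length_le1 n.
have c4 := chord2_le4 (gap_length n / 3).
have c0 : 0 < chord2 (gap_length n / 3).
  by apply: chord2_gt0; have := pi_ge2 R; lra.
by rewrite /radius; split; lra.
Qed.

Lemma gap_middle_dist n k s t : (k < 2 ^ n)%N -> cantor_set lam s ->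
  gap_middle n k t -> gap_length n / 3 <= `|s - t| <= 1.
Proof.
move=> kn Ks; rewrite /gap_middle /= in_itv/= => /andP[t1 t2].
have := cantor_unit lam0 lam12 Ks; rewrite /= in_itv/= => s01.
have g0 := gap_length_gt0 n.
have lo := cantor_unit lam0 lam12 (cantor_gap_lo lam0 lam12 kn).
have hi := cantor_unit lam0 lam12 (cantor_gap_hi lam0 lam12 kn).
rewrite /= !in_itv/= in lo hi.
apply/andP; split; last by rewrite ler_norml; lra.
have [sl|ls] := leP s (gap_lo lam n k).
  by rewrite distrC ler_normr; lra.
have [hs|sh] := leP (gap_hi lam n k) s.
  by rewrite ler_normr; lra.
by case: (gap_cantor lam0 lam12 kn _ Ks); rewrite ls sh.
Qed.

(** |S'| = |S| |H'|, where S = exp(-H).  The Poisson kernel is at most 1/2 on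
    the support, which bounds |S| below; and |H'| is at least the real part of
    - exp(i t) H', an integral of a nonnegative function which over the cell is
    at least a multiple of the inverse square of the length of the cell. *)
Lemma derivative_lower n k t : (k < 2 ^ n)%N -> gap_middle n k t ->
  expR (- (1 / 2)) * (8 / 25) * (lam ^+ n) ^- 2 *
    fine (nu (@expi R @` cell lam n k `&` E)) <=
  normc (derive1 (singular_inner nu) ((radius n)%:C * expi t)).
Proof.
move=> kn tm; have [r0 r1 r8] := radiusP n.
set r := radius n in r0 r1 r8 *; set z := r%:C * expi t.
have nz : normc z = r.
  by rewrite normcM normc_expi mulr1 /= expr0n addr0 sqrtr_sqr ger0_norm.
have z1 : normc z < 1 by rewrite nz.
have angle s : cantor_set lam s -> 8 * (1 - r) <= chord2 (s - t) /\ 0 < chord2 (s - t).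
  move=> Ks; have /andP[st1 st2] := gap_middle_dist kn Ks tm.
  have p2 := pi_ge2 R; have g0 := gap_length_gt0 n; have g1 := gap_length_le1 n.
  have c0 : 0 < chord2 (gap_length n / 3) by apply: chord2_gt0; lra.
  have : chord2 (gap_length n / 3) <= chord2 (s - t) by apply: chord2_ge; lra.
  by rewrite r8 => h; split => //; exact: lt_le_trans h.
have on_E w : E w -> exists2 s, cantor_set lam s & w = expi s.
  by move=> [s Ks <-]; exists s.
rewrite singular_inner_derive1// normcM.
have [mK bK] := herglotz_cbounded z1; have bG := dherglotz_cbounded z1.
have hS : expR (- (1 / 2)) <= normc (singular_inner nu z).
  rewrite /singular_inner normc_cexp ler_expR /= lerN2.
  apply: (Rintegral_support_le mK.1 (M := 2 / (1 - normc z))).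
  - by move=> w cw; apply: le_trans (normc_Re _) (bK _ cw).
  - by [].
  - by move=> w /on_E[s /angle[h1 h2] ->]; exact: poisson_kernel_le.
have hG : 8 / 25 * (lam ^+ n) ^- 2 * fine (nu (@expi R @` cell lam n k `&` E)) <=
    normc (- dherglotz nu z).
  (* The unimodular factor that makes the real part of the kernel positive. *)
  pose c : R[i] := - expi t.
  have nc : normc c = 1 by rewrite normcN normc_expi.
  have bcG : cbounded (fun w => c * (2 * w / (w - z) ^+ 2)) (2 / (1 - normc z) ^+ 2).
    split; first exact: cmeasurableM (cmeasurable_cst c) bG.1.
    by move=> w cw; rewrite normcM nc mul1r; exact: bG.2.
  apply: (@le_trans _ _ (complex.Re (c * dherglotz nu z))); last first.
    rewrite normcN -[leRHS]mul1r -nc -normcM.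
    exact: le_trans (ler_norm _) (normc_Re _).
  rewrite /dherglotz -(cintegralZ nuTfin c bG) /=.
  have kernel s : cantor_set lam s ->
      8 / (25 * chord2 (s - t)) <= complex.Re (c * (2 * expi s / (expi s - z) ^+ 2)).
    move=> /angle[h1 h2].
    by rewrite mulNr raddfN; exact: dherglotz_kernel_ge.
  apply: (Rintegral_support_ge bcG.1.1 (M := 2 / (1 - normc z) ^+ 2)).
  - by move=> w cw; apply: le_trans (normc_Re _) (bcG.2 _ cw).
  - apply: measurableI; last exact: measurable_circular_cantor.
    by apply: borelC_closed; apply: expi_closed; exact: segment_compact.
  - by move=> w [].
  - move=> w /on_E[s Ks ->]; apply: le_trans (kernel s Ks).
    by rewrite divr_ge0// mulr_ge0// ltW//; case: (angle s Ks).
  - move=> w [[s scell sw] /on_E[s' Ks' ws']].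
    have s01 := cell_unit lam0 lam12 scell.
    have s'01 := cantor_unit lam0 lam12 Ks'.
    rewrite /= !in_itv/= in s01 s'01.
    have ss' : s = s'.
      by apply: expi_inj; [have := pi_ge2 R; rewrite ltr_norml; lra|rewrite sw].
    rewrite -sw; rewrite -ss' in Ks'; apply: le_trans (kernel s Ks').
    have [_ x0] := angle s Ks'.
    rewrite [leRHS](_ : _ = 8 / 25 * (chord2 (s - t))^-1); last first.
      by field; rewrite gt_eqF.
    rewrite ler_pM2l// lef_pV2 ?posrE ?exprn_gt0//.
    apply: le_trans (chord2_le _) _.
    have tcell : cell lam n k t.
      apply: (gap_cell lam0); move: tm; rewrite /gap_middle /= !in_itv/=.
      by have := gap_length_gt0 n; lra.
    move/cellP: scell => scell; move/cellP: tcell => tcell.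
    rewrite -[leLHS]real_normK ?num_real// ler_pXn2r ?nnegrE ?exprn_ge0 ?(ltW lam0)//.
    by rewrite ler_norml; lra.
have -> : expR (- (1 / 2)) * (8 / 25) * lam ^+ n ^- 2 *
    fine (nu (@expi R @` cell lam n k `&` E)) =
  (8 / 25 * lam ^+ n ^- 2 * fine (nu (@expi R @` cell lam n k `&` E))) *
    expR (- (1 / 2)).
  by ring.
apply: (ler_pM _ (expR_ge0 _) hG hS).
by rewrite !mulr_ge0 ?invr_ge0 ?exprn_ge0 ?fine_ge0 ?(ltW lam0).
Qed.

End derivative_on_gaps.

(** * Growth of the integral means *)

Section hardy_mean_bound.
Set Implicit Arguments.
Unset Strict Implicit.
Context {R : realType}.
Implicit Types (p r : R) (f : R[i] -> R[i]).

Lemma continuous_normc : continuous (@normc R : R[i] -> R).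
Proof.
move=> z A /nbhs_ballP[e /= e0 eA]; apply/nbhs_normcP; exists e => // w wz.
apply: eA; rewrite -ball_normE /= distrC; apply: le_lt_trans wz.
rewrite ler_norml normc_leB andbT lerNl opprB.
by apply: le_trans (normc_leB _ _) _; rewrite -normcN opprB.
Qed.

(** A holomorphic function is continuous on the circles inside the disk. *)
Lemma holomorphic_mean_measurable p r f : 0 <= r -> r < 1 ->
  holomorphic (@disk R) f ->
  measurable_fun setT
    (fun t : R => ((complex.Re `|f (r%:C * expi t)|) `^ p)%:E).
Proof.
move=> r0 r1 hf; apply/measurable_EFinP.
apply: (@measurableT_comp _ _ _ _ _ _ (fun x : R => x `^ p)).
  exact: measurable_powR.
apply: continuous_measurable_fun => t.
have zcont : continuous (fun t : R => r%:C * expi t : R[i]).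
  rewrite [X in continuous X](_ : _ = (fun t => (r * cos t) +i* (r * sin t))).
    apply: continuous_complex => s; apply: cvgM; try exact: cvg_cst.
      exact: continuous_cos.
    exact: continuous_sin.
  apply/funext => s; rewrite /expi; apply/eqP.
  by rewrite eq_complex /= !mul0r subr0 addr0 !eqxx.
have fcont : {for r%:C * expi t, continuous f}.
  apply: differentiable_continuous; apply/derivable1_diffP; apply: hf.
  rewrite /disk /= normc_normr normcM normc_expi mulr1 /= expr0n addr0 sqrtr_sqr.
  by rewrite ger0_norm// ltcR.
apply: (@continuous_comp _ _ _ (fun t : R => f (r%:C * expi t)) (@normc R)).
  by apply: continuous_comp; [exact: zcont|exact: fcont].
exact: continuous_normc.
Qed.

(** v^p = v * v^(p-1), and the exponent p - 1 is negative. *)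
Lemma powR_concave_bound p (v N : R) :
  0 < p -> p < 1 -> 0 <= v -> 0 < N -> v <= N^-1 ->
  v * N `^ (1 - p) <= v `^ p.
Proof.
move=> p0 p1; rewrite le_eqVlt => /predU1P[<-|v0] N0 vN.
  by rewrite mul0r powR_ge0.
have vE : v = v `^ p * v `^ (1 - p).
  rewrite -powRD; last by rewrite (gt_eqF v0) implybT.
  by rewrite [p + _]addrC subrK powRr1 // ltW.
rewrite [X in X * _]vE -mulrA -powRM ?(ltW v0) ?(ltW N0)// ler_piMr ?powR_ge0//.
have e1 : 1 = 1 `^ (1 - p) :> R by rewrite powR1.
rewrite [leRHS]e1; apply: ge0_ler_powR.
- by rewrite subr_ge0 ltW.
- by rewrite nnegrE mulr_ge0 ?(ltW v0) ?(ltW N0).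
- by rewrite nnegrE.
- by rewrite -ler_pdivlMr// mul1r.
Qed.

End hardy_mean_bound.

Section divergence.
Set Implicit Arguments.
Unset Strict Implicit.
Context {R : realType}.
Variable lam : R.
Hypotheses (lam0 : 0 < lam) (lam12 : lam < 1 / 2).
Variable nu : {measure set (borelC R) -> \bar R}.
Hypothesis nuT : (nu setT <= 1)%E.
Hypothesis nuE : nu (~` circular_cantor lam) = 0%E.
Hypothesis nu_cell : forall n k, (k < 2 ^ n)%N ->
  (nu (@expi R @` cell lam n k) <= (2 ^- n)%:E)%E.
Implicit Types (n k : nat).

Notation E := (circular_cantor lam).

Definition cell_mass n k : R := fine (nu (@expi R @` cell lam n k `&` E)).

Lemma measurable_cellE n k : measurable (@expi R @` cell lam n k `&` E : set (borelC R)).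
Proof.
apply: measurableI; last exact: measurable_circular_cantor.
by apply: borelC_closed; apply: expi_closed; exact: segment_compact.
Qed.

Lemma cell_mass_fin n k : nu (@expi R @` cell lam n k `&` E) = (cell_mass n k)%:E.
Proof.
rewrite /cell_mass fineK// ge0_fin_numE ?measure_ge0//.
apply: le_lt_trans (ltry 1); apply: le_trans nuT; apply: le_measure; rewrite ?inE//.
exact: measurable_cellE.
Qed.

Lemma cell_mass_ge0 n k : 0 <= cell_mass n k.
Proof. exact: fine_ge0. Qed.

Lemma cell_mass_le n k : (k < 2 ^ n)%N -> cell_mass n k <= (2 ^+ n)^-1.
Proof.
move=> kn; rewrite -lee_fin -cell_mass_fin; apply: le_trans (nu_cell kn).
apply: le_measure; rewrite ?inE; [exact: measurable_cellE| |exact: subIsetl].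
by apply: borelC_closed; apply: expi_closed; exact: segment_compact.
Qed.

(** nu is carried by the union of the cells of generation n. *)
Lemma sum_cell_mass n : fine (nu setT) <= \sum_(k < 2 ^ n) cell_mass n k.
Proof.
have mE := measurable_circular_cantor lam0 lam12.
have cover : E `<=` \big[setU/set0]_(k < 2 ^ n) (@expi R @` cell lam n k `&` E).
  rewrite -(bigcup_mkord _ (fun k => @expi R @` cell lam n k `&` E)).
  move=> w [s Ks sw]; have [k kn sk] := Ks n Logic.I.
  by exists k => //; split; exists s.
have mB k : `I_(2 ^ n) k -> measurable (@expi R @` cell lam n k `&` E : set (borelC R)).
  by move=> _; exact: measurable_cellE.
have := content_subadditive nu mB mE cover.
rewrite (eq_bigr (fun k : 'I_(2 ^ n) => (cell_mass n k)%:E)); last first.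
  by move=> k _; exact: cell_mass_fin.
rewrite sumEFin => h.
rewrite -lee_fin fineK; last first.
  by rewrite ge0_fin_numE ?measure_ge0//; exact: le_lt_trans nuT (ltry _).
apply: le_trans h; rewrite -(setvU E).
rewrite measureU//.
- by rewrite [X in (X + _)%E](_ : _ = 0%E) ?add0e.
- exact: measurableC.
- by rewrite setICl.
Qed.

(** The factor by which the lower bound on the means grows per generation:
    lam^(1-2p) is the length lam of a gap times the p-th power of the kernel
    size lam^-2, and 2^(1-p) is the gain of powR_concave_bound. *)
Definition growth p : R := lam `^ (1 - 2 * p) * 2 `^ (1 - p).

Definition growth_cst p : R :=
  (expR (- (1 / 2)) * (8 / 25)) `^ p * ((1 - 2 * lam) / 3).

(** The middle thirds of the gaps of generation n are disjoint, and on each of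
    them the integrand is bounded below by derivative_lower. *)
Lemma hardy_mean_lower p n : 0 < p -> p < 1 ->
  holomorphic (@disk R) (derive1 (singular_inner nu)) ->
  ((growth_cst p * growth p ^+ n * fine (nu setT))%:E <=
   hardy_mean p (derive1 (singular_inner nu)) (radius lam n))%E.
Proof.
move=> p0 p1 hol; have [r0 r1 _] := radiusP lam0 lam12 n.
set f := derive1 (singular_inner nu) in hol *.
pose phi (t : R) := ((complex.Re `|f ((radius lam n)%:C * expi t)|) `^ p)%:E.
have mphi := holomorphic_mean_measurable p r0 r1 hol; rewrite -/phi in mphi.
have phi0 t : (0 <= phi t)%E by rewrite lee_fin powR_ge0.
pose M (k : 'I_(2 ^ n)) : set R := gap_middle lam n k.
have mM i : measurable (M i) by exact: measurable_itv.
have g0 := gap_length_gt0 lam0 lam12 n.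
have M_cell (k : 'I_(2 ^ n)) : M k `<=` cell lam n k.
  move=> t; rewrite /M /gap_middle /= in_itv/= => tM; apply: (gap_cell lam0).
  by rewrite /= in_itv/=; lra.
have tM : trivIset [set` index_enum 'I_(2 ^ n)] M.
  apply/trivIsetP => i j _ _ /eqP ij; apply/seteqP; split => // t [ti tj].
  apply: ij; apply: val_inj.
  exact: (cell_inj lam0 lam12 _ _ (M_cell _ _ ti) (M_cell _ _ tj)).
have MU : \big[setU/set0]_(k <- index_enum 'I_(2 ^ n)) M k `<=` `[0, 2 * pi].
  move=> t; rewrite -bigcup_seq => -[k _] /M_cell/(cell_unit lam0 lam12).
  by rewrite /= !in_itv/=; have := pi2_gt1 (R := R); lra.
apply: (@le_trans _ _ (\int[lebesgue_measure]_(t in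
    \big[setU/set0]_(k <- index_enum 'I_(2 ^ n)) M k) phi t)%E); last first.
  apply: ge0_subset_integral => //.
  - by apply: bigsetU_measurable => i _; exact: mM.
  - exact: measurable_funS mphi.
rewrite ge0_integral_bigsetU//; [|exact: index_enum_uniq|exact: measurable_funS mphi].
pose c k := (expR (- (1 / 2)) * (8 / 25) * (lam ^+ n) ^- 2 * cell_mass n k) `^ p.
apply: (@le_trans _ _ (\sum_(k < 2 ^ n) (c k * (gap_length lam n / 3))%:E)%E); last first.
  apply: lee_sum => k _.
  apply: (@le_trans _ _ (\int[lebesgue_measure]_(t in M k) (cst (c k)%:E t))%E).
    rewrite integral_cst; last exact: mM.
    rewrite [X in (_ * X)%E](_ : _ = lebesgue_measure (gap_middle lam n k : set R))//.
    rewrite /gap_middle lebesgue_measure_itv/= lte_fin.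
    have gs := gap_size lam n k; rewrite -/(gap_length lam n) in gs.
    rewrite ifT; last by lra.
    by rewrite -EFinB -EFinM lee_fin ler_wpM2l ?powR_ge0//; lra.
  apply: ge0_le_integral => //.
  - exact: mM.
  - by move=> t _; rewrite lee_fin powR_ge0.
  - exact: measurable_funS mphi.
  - move=> t Mt; rewrite lee_fin; apply: ge0_ler_powR.
    + exact: ltW.
    + rewrite nnegrE !mulr_ge0 ?expR_ge0 ?cell_mass_ge0 ?invr_ge0//.
      by rewrite exprn_ge0 ?exprn_ge0 ?(ltW lam0).
    + by rewrite nnegrE; exact: normc_ge0.
    + exact: (derivative_lower lam0 lam12 nuT nuE (ltn_ord k) Mt).
rewrite sumEFin lee_fin -mulr_suml.
pose A := expR (- (1 / 2)) * (8 / 25) : R; pose y := lam ^+ n.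
have y0 : 0 < y by rewrite exprn_gt0.
have A0 : 0 <= A by rewrite mulr_ge0// expR_ge0.
pose D := A `^ p * (y ^- 2) `^ p * (2 ^+ n) `^ (1 - p).
have D0 : 0 <= D by rewrite !mulr_ge0// powR_ge0.
have cD k : (k < 2 ^ n)%N -> D * cell_mass n k <= c k.
  have L0 : 0 <= y ^- 2 by rewrite invr_ge0 exprn_ge0// ltW.
  have -> : c k = A `^ p * (y ^- 2) `^ p * cell_mass n k `^ p.
    rewrite /c -/A -/y powRM ?cell_mass_ge0 ?mulr_ge0//.
    by congr (_ * _); exact: powRM.
  move=> kn; rewrite /D -!mulrA ler_wpM2l ?powR_ge0// ler_wpM2l ?powR_ge0//.
  rewrite mulrC powR_concave_bound ?cell_mass_ge0 ?exprn_gt0//.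
  exact: cell_mass_le.
have sumD : D * fine (nu setT) <= \sum_(k < 2 ^ n) c k.
  apply: (@le_trans _ _ (\sum_(k < 2 ^ n) D * cell_mass n k)).
    by rewrite -mulr_sumr ler_wpM2l// sum_cell_mass.
  by apply: ler_sum => k _; exact: cD.
have gE : growth p ^+ n = y * (y ^- 2) `^ p * (2 ^+ n) `^ (1 - p).
  have -> : y * (y ^- 2) `^ p = y `^ (1 - 2 * p).
    rewrite -(powR_invn 2 (ltW y0)) -powRrM -[X in X * _](powRr1 (ltW y0)) -powRD.
      by congr (_ `^ _); ring.
    by rewrite (gt_eqF y0) implybT.
  by rewrite /growth exprMn /y !powR_exprn ?(ltW lam0).
have -> : growth_cst p * growth p ^+ n * fine (nu setT) =
    D * fine (nu setT) * (gap_length lam n / 3).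
  by rewrite gE /growth_cst /D -/A /gap_length -/y; ring.
by rewrite ler_wpM2r// divr_ge0// ltW.
Qed.

End divergence.

(** * The choice of the ratio and the conclusion *)

Lemma geometric_unbounded (R : realType) (rho K B : R) : 1 < rho -> 0 < K ->
  exists n, B < K * rho ^+ n.
Proof.
move=> rho1 K0; have rho0 : 0 < rho by exact: lt_trans rho1.
pose B' := Num.max B 1; have B'0 : 0 < B' by rewrite lt_max ltr01 orbT.
have e0 : 0 < K / B' by rewrite divr_gt0.
have : (rho^-1) ^+ n @[n --> \oo] --> (0 : R).
  by apply: cvg_expr; rewrite ger0_norm ?invr_ge0 ?ltW// invf_lt1.
move=> /cvgr0_norm_lt/(_ _ e0)[n _ /(_ n (leqnn _))].
rewrite ger0_norm ?exprn_ge0 ?invr_ge0 ?ltW// exprVn => h; exists n.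
apply: (@le_lt_trans _ _ B'); first by rewrite le_max lexx.
have rn : 0 < rho ^+ n by rewrite exprn_gt0.
by move: h; rewrite ltr_pdivlMr// mulrC ltr_pdivrMr.
Qed.

Lemma not_hardy_of_growth (R : realType) (lam p : R)
    (nu : {measure set (borelC R) -> \bar R}) :
  0 < lam -> lam < 1 / 2 -> 0 < p -> p < 1 -> 1 < growth lam p ->
  (nu setT <= 1)%E -> nu setT != 0%E -> nu (~` circular_cantor lam) = 0%E ->
  (forall n k, (k < 2 ^ n)%N ->
    (nu (@expi R @` cell lam n k) <= (2 ^- n)%:E)%E) ->
  ~ hardy p (derive1 (singular_inner nu)).
Proof.
move=> lam0 lam12 p0 p1 rho1 nuT nu0 nuE nu_cell [hol].
set S := ereal_sup _ => Sfin.
have lower n : ((growth_cst lam p * growth lam p ^+ n * fine (nu setT))%:E <= S)%E.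
  have [r0 r1 _] := radiusP lam0 lam12 n.
  apply: le_trans (hardy_mean_lower lam0 lam12 nuT nuE nu_cell n p0 p1 hol) _.
  by apply: ereal_sup_ubound; exists (radius lam n) => //=; rewrite in_itv/= r0.
have nuTfin : nu setT \is a fin_num.
  by rewrite ge0_fin_numE ?measure_ge0//; exact: le_lt_trans nuT (ltry _).
have V0 : 0 < fine (nu setT).
  by rewrite fine_gt0// lt0e nu0 measure_ge0 /= (le_lt_trans nuT) ?ltry.
have K0 : 0 < growth_cst lam p * fine (nu setT).
  rewrite /growth_cst !mulr_gt0// ?powR_gt0 ?mulr_gt0 ?expR_gt0//; lra.
have [n] := @geometric_unbounded R _ _ (fine S) rho1 K0.
rewrite mulrAC; apply/negP; rewrite -leNgt -lee_fin fineK//.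
rewrite fin_numE -ltey Sfin andbT -ltNye.
by apply: lt_le_trans (lower 0%N); rewrite ltNyr.
Qed.

(** For lam = 2^-s the two conditions on the ratio read s > 1 / (1 - q) and
    s < (1 - p) / (1 - 2 p); the bound lam < 1/2 is s > 1. *)
Lemma cantor_ratio_exists (R : realType) (p q : R) :
  0 < p -> p < 1 / 2 -> 0 < q -> q < p / (1 - p) ->
  exists lam : R, [/\ 0 < lam, lam < 1 / 2, 0 < 1 - q,
    2 * lam `^ (1 - q) < 1 & 1 < growth lam p].
Proof.
move=> p0 p12 q0 qp.
have p1 : 0 < 1 - p by lra.
have p2 : 0 < 1 - 2 * p by lra.
move: qp; rewrite ltr_pdivlMr// => qp.
have q1 : 0 < 1 - q by nra.
pose a := (1 - q)^-1; pose b := (1 - p) / (1 - 2 * p).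
have ab : a < b by rewrite /a /b ltr_pdivlMr// mulrC ltr_pdivrMr//; lra.
have a1 : 1 < a by rewrite /a invf_gt1//; lra.
pose s := (a + b) / 2.
have as_ : a < s by rewrite /s; lra.
have sb : s < b by rewrite /s; lra.
have two1 : 1 < 2 :> R by lra.
have pow2 (x y : R) : x < y -> 2 `^ x < 2 `^ y.
  by move=> xy; rewrite /powR pnatr_eq0 /= ltr_expR ltr_pM2r// ln_gt0.
exists (2 `^ (- s)); split => //.
- have -> : 1 / 2 = 2 `^ (- 1) :> R by rewrite powR_inv1// mul1r.
  by apply: pow2; lra.
- rewrite -powRrM -[X in X * _](powRr1 (ltW (ltr0Sn R 1))) -powRD.
    rewrite -[ltRHS](powRr0 2); apply: pow2.
    have : a * (1 - q) = 1 by rewrite /a mulVf// gt_eqF.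
    nra.
  by rewrite pnatr_eq0 implybT.
- rewrite /growth -powRrM -powRD ?pnatr_eq0 ?implybT//.
  rewrite -[ltLHS](powRr0 2); apply: pow2.
  have : b * (1 - 2 * p) = 1 - p by rewrite /b divfK// gt_eqF.
  nra.
Qed.

Theorem lemma5p5 (R : realType) (p q : R) :
  0 < p -> p < 1 / 2 -> 0 < q -> q < p / (1 - p) ->
  exists (E : set R[i]) (mu : {finite_measure set (borelC R) -> \bar R}),
    [/\ beurling_carleson (1 - q) E,
        mu setT != 0%E,
        mu (~` E) = 0%E &
        forall nu : {measure set (borelC R) -> \bar R},
          (forall A, measurable A -> (nu A <= mu A)%E) ->
          nu setT != 0%E ->
          ~ hardy p (derive1 (singular_inner nu))].
Proof.
move=> p0 p12 q0 qp.
have [lam [lam0 lam12 q1 lam_carleson lam_growth]] :=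
  @cantor_ratio_exists R p q p0 p12 q0 qp.
have [mu [muT muE mu_cell]] := @cantor_measure_exists R lam lam0 lam12.
exists (circular_cantor lam), mu; split => //.
- exact: circular_cantor_carleson.
- by rewrite muT.
- move=> nu nu_mu nu0.
  apply: (@not_hardy_of_growth R lam p nu lam0 lam12 p0 _ lam_growth) => //.
  + lra.
  + by rewrite -muT; exact: nu_mu.
  + apply/eqP; rewrite eq_le measure_ge0 andbT -muE; apply: nu_mu.
    by apply: measurableC; exact: measurable_circular_cantor.
  + move=> n k kn; apply: le_trans (mu_cell n k kn); apply: nu_mu.
    by apply: borelC_closed; apply: expi_closed; exact: segment_compact.
Qed.
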